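(* Let $r\ge 1$ and $m\ge 1$ be integers. For each $n\ge 1$, let $\lambda$ be a partition chosen uniformly at random from the set $P_r(n)$ of all partitions of $n$ with non negative $r^{th}$ differences. Given $\lambda=(\lambda_1,\dots,\lambda_k)$, let $d(\lambda)$ be a positive $r^{th}$ difference of $\lambda$ chosen uniformly at random among the positive $r^{th}$ differences occurring in $\lambda$; that is, $d(\lambda)=\Delta^r_I(\lambda)$, where the index $I$ is uniformly distributed on $\{i : 1\le i\le k,\ \Delta^r_i(\lambda)>0\}$. Then the probability that $d(\lambda)\ge m$ converges to $m^{-1/r}$ as $n\to\infty$. Equivalently, $$\lim_{n\to\infty}\frac{1}{|P_r(n)|}\sum_{\lambda\in P_r(n)}\frac{|\{i:\Delta^r_i(\lambda)\ge m\}|}{|\{i:\Delta^r_i(\lambda)\ge 1\}|}=m^{-1/r}.$$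
   Context: A partition of $n$ is a sequence of integers $\lambda=(\lambda_1,\dots,\lambda_k)$ with $\lambda_1\ge\lambda_2\ge\dots\ge\lambda_k\ge1$ and $\sum_{j=1}^k\lambda_j=n$; $k$ is its number of parts. For an integer $r\ge 0$, the $r^{th}$ differences $\Delta^r_i(\lambda)$, $1\le i\le k$, are defined recursively by $\Delta^r_i(\lambda)=\lambda_i$ if $i=k$ or $r=0$, and $\Delta^r_i(\lambda)=\Delta^{r-1}_i(\lambda)-\Delta^{r-1}_{i+1}(\lambda)$ otherwise. $P_r(n)$ is the set of partitions $\lambda=(\lambda_1,\dots,\lambda_k)$ of $n$ such that $\Delta^r_i(\lambda)\ge0$ for all $1\le i\le k$. *)

(* Defs.v *)
From HB Require Import structures.
From mathcomp Require Import all_boot all_order all_algebra.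
From mathcomp Require Import finmap.
From mathcomp Require Import all_classical all_reals all_analysis.

Set Implicit Arguments.
Unset Strict Implicit.
Unset Printing Implicit Defensive.

Import Order.TTheory GRing.Theory Num.Theory.
Local Open Scope ring_scope.

Definition is_partition (n : nat) (l : seq nat) : bool :=
  [&& sorted geq l, all (leq 1) l & sumn l == n].

(* Indices are 1-based: i ranges over 1, ..., k with k = size l, and the part
   lambda_i is nth 0 l i.-1.  Values outside this range are irrelevant. *)
Fixpoint rdiff (l : seq nat) (r i : nat) : int :=
  if r is r'.+1 then
    if i == size l then (nth 0%N l i.-1)%:Z
    else rdiff l r' i - rdiff l r' i.+1
  else (nth 0%N l i.-1)%:Z.

Definition indices (l : seq nat) : {fset nat} :=
  [fset i in iota 1 (size l)]%fset.

Definition diff_partition_set (r n : nat) : set (seq nat) :=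
  [set l | is_partition n l /\
           forall i : nat, i \in indices l -> 0 <= rdiff l r i]%classic.

Lemma finite_diff_partitions (r n : nat) : finite_set (diff_partition_set r n).
Proof.
pose s := [seq map (@nat_of_ord n.+1) (bseqval b)
          | b <- enum {: {bseq n of 'I_n.+1}}].
apply: (@sub_finite_set _ _ [set` s]); last exact: finite_seq.
move=> l [/and3P[_ l1 /eqP ln] _] /=.
have szl : (size l <= n)%N.
  rewrite -ln; elim: l l1 {ln} => //= a l IH /andP[a1 /IH h].
  by rewrite -add1n leq_add.
have lle : all (fun a => a <= n)%N l.
  rewrite -ln; apply/allP => a al.
  rewrite sumnE (big_rem a al) /=; exact: leq_addr.
have szb : (size (map (@inord n) l) <= n)%N by rewrite size_map.
apply/mapP; exists (Bseq szb); first by rewrite mem_enum.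
rewrite /= -map_comp -[LHS]map_id; apply/eq_in_map => a /(allP lle) an /=.
by rewrite inordK.
Qed.

(* fset_set is meaningful on finite sets only, see finite_diff_partitions. *)
Definition diff_partitions (r n : nat) : {fset seq nat} :=
  fset_set (diff_partition_set r n).

Lemma in_diff_partitions (r n : nat) (l : seq nat) :
  l \in diff_partitions r n <-> diff_partition_set r n l.
Proof.
rewrite /diff_partitions in_fset_set; last exact: finite_diff_partitions.
by rewrite inE.
Qed.

(* Expectation of f x, resp. probability of E x, for x uniformly distributed
   on the finite set A. *)
Definition unif_expectation (R : realType) (T : choiceType) (A : {fset T})
    (f : T -> R) : R :=
  (\sum_(x <- A) f x) / #|` A|%:R.

Definition unif_prob (R : realType) (T : choiceType) (A : {fset T})
    (E : pred T) : R :=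
  #|` [fset x in A | E x]%fset|%:R / #|` A|%:R.

Definition positive_indices (r : nat) (l : seq nat) : {fset nat} :=
  [fset i in indices l | 0 < rdiff l r i]%fset.

(* Two-stage experiment: lambda is uniform on diff_partitions r n and,
   conditionally on lambda, I is uniform on positive_indices r lambda, so the
   probability that
   d(lambda) = Delta^r_I(lambda) >= m is the expectation over lambda of the
   conditional probability given lambda. *)
Definition prob_d_ge (R : realType) (r n m : nat) : R :=
  unif_expectation (diff_partitions r n) (fun l =>
    unif_prob R (positive_indices r l) (fun i => m%:Z <= rdiff l r i)).

Definition num_ge (r m : nat) (l : seq nat) : nat :=
  #|` [fset i in indices l | m%:Z <= rdiff l r i]%fset|.

(* Main.v *)
(* Let b_i = 'C(i + r, r).  Taking r-th differences turns P_r(n) into the set of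
   multiplicity vectors d with sum_i b_i d_i = n, d_i = Delta^r_(i+1), so the
   quantity to average is X_m / X_1, where X_m = #{i : d_i >= m}.

   Under the Boltzmann law the d_i are independent and P(d_i >= k) =
   exp(- t b_i k), and conditioning on the total weight n gives the uniform law
   on P_r(n).  Three elementary facts then suffice, with mu(t) = sum_i
   exp(- t b_i) = E X_1, of order t^(-1/r).
   1. Chernoff: X_m deviates from its mean mu(m t) by a factor 1 +- eps with
      probability at most 2 exp(- eps^2 mu(m t) / 8).
   2. Conditioning is cheap: choosing t so that the mean weight is (1 - delta) n,
      Chebyshev puts the weight in [(1 - 2 delta) n, n] with probability 1/2;
      since 1 is an allowed part, the number of partitions increases with the
      weight, so conditioning on weight n costs at most a factor
      2 (n + 1) exp(16 delta (mu(t) + r + 1)), which loses to the Chernoff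
      bound when delta is small with respect to eps^2.
   3. mu(m t) / mu(t) tends to m^(-1/r) as t -> 0: up to O(r), mu(t) is the
      sum over j of exp(- s j^r) with s = t / r!, and cutting this sum into
      blocks of length p compares its values at s and p^r s; rational
      approximation of m^(1/r) does the rest, so no integral is needed.

   To stay finite, d_i is truncated to min(d_i, n + 1), which does not change
   the law of the configurations of weight at most n. *)

Require Import Defs.
From HB Require Import structures.
From mathcomp Require Import all_boot all_order all_algebra.
From mathcomp Require Import finmap.
From mathcomp Require Import all_classical all_reals all_analysis.
From mathcomp Require Import ring lra zify.

Set Implicit Arguments.
Unset Strict Implicit.
Unset Printing Implicit Defensive.

Import Order.TTheory GRing.Theory Num.Theory.
Import numFieldNormedType.Exports.
Local Open Scope classical_set_scope.
Local Open Scope ring_scope.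

(** * Partitions and multiplicities of r-th differences *)

Lemma rdiff_out (l : seq nat) (r i : nat) : (size l < i)%N -> rdiff l r i = 0.
Proof.
elim: r i => [|r IH] i li /=.
  by rewrite nth_default //; case: i li.
by rewrite gtn_eqF // !IH ?subrr // ltnW.
Qed.

Lemma rdiff_size (l : seq nat) (r : nat) :
  rdiff l r (size l) = (nth 0%N l (size l).-1)%:Z.
Proof. by case: r => //= r; rewrite eqxx. Qed.

(** The boundary case of the definition is the general recursion with zeros past the end, so no case
    distinction is needed afterwards. *)
Lemma rdiffS (l : seq nat) (r i : nat) :
  rdiff l r.+1 i = rdiff l r i - rdiff l r i.+1.
Proof.
rewrite /=; case: eqP => // ->.
by rewrite rdiff_size (@rdiff_out _ _ (size l).+1) // subr0.
Qed.

(** Summation by parts: by Pascal's rule, consecutive coefficients on the left differ by 'C(i + r,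
    r). *)
Lemma abel_binomial (f : nat -> int) (r K : nat) :
  \sum_(i < K) 'C(i + r.+1, r.+1)%:Z * (f i - f i.+1) =
  \sum_(i < K) 'C(i + r, r)%:Z * f i - 'C(K + r, r.+1)%:Z * f K.
Proof.
elim: K => [|K IH]; first by rewrite !big_ord0 bin_small ?mul0r ?subr0.
rewrite !big_ord_recr /= IH addnS addSn binS PoszD.
ring.
Qed.

Lemma sum_rdiff (l : seq nat) (r K : nat) : (size l <= K)%N ->
  \sum_(i < K) 'C(i + r, r)%:Z * rdiff l r i.+1 = (sumn l)%:Z.
Proof.
move=> lK; elim: r => [|r <-].
  rewrite (eq_bigr (fun i : 'I_K => (nth 0%N l i)%:Z)); last first.
    by move=> i _; rewrite bin0 mul1r.
  rewrite -(big_mkord xpredT (fun i => (nth 0%N l i)%:Z)) (@big_cat_nat _ _ _ (size l)) //=.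
  rewrite [X in _ + X]big_nat_cond [X in _ + X]big1 ?addr0; last first.
    by move=> i /andP[/andP[li _] _]; rewrite nth_default.
  rewrite big_mkord; elim: l {lK} => [|a l IH] /=; first by rewrite big_ord0.
  by rewrite big_ord_recl /= IH PoszD.
under eq_bigr do rewrite rdiffS.
by rewrite (abel_binomial (fun i => rdiff l r i.+1)) rdiff_out ?ltnS // mulr0 subr0.
Qed.

(** Differences of order r + 1 determine those of order r by descending induction on the index,
    starting past both ends. At order 0, positivity of the parts recovers the length. *)
Lemma rdiff_inj (l l' : seq nat) (r : nat) : all (leq 1) l -> all (leq 1) l' ->
  (forall i, rdiff l r i.+1 = rdiff l' r i.+1) -> l = l'.
Proof.
move=> l1 l'1 eqr.
have {eqr} : forall i, rdiff l 0 i.+1 = rdiff l' 0 i.+1.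
  elim: r eqr => // r IH eqr; apply: IH => i.
  have [k] := ubnP (size l + size l' - i)%N.
  elim: k i => // k IH i ki.
  have [lti|lei] := ltnP i (size l + size l').
    have := eqr i; rewrite !rdiffS (IH i.+1); last by lia.
    by move/addIr.
  by rewrite !rdiff_out //; lia.
move=> eq0.
have {}eq0 i : nth 0%N l i = nth 0%N l' i by have := eq0 i; case.
have pos (s : seq nat) i : all (leq 1) s -> (i < size s)%N -> (0 < nth 0%N s i)%N.
  by move=> /all_nthP; apply.
have sz : size l = size l'.
  apply/eqP; rewrite eqn_leq; apply/andP; split; rewrite leqNgt; apply/negP => lt.
    by have := pos _ _ l1 lt; rewrite eq0 nth_default.
  by have := pos _ _ l'1 lt; rewrite -eq0 nth_default.
exact: eq_from_nth sz (fun i _ => eq0 i).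
Qed.

(** Inverse of the difference operator on sequences that vanish from [K] on. *)
Definition tailsum (K : nat) (f : nat -> nat) (i : nat) : nat :=
  (\sum_(i <= j < K) f j)%N.

Lemma tailsumS (K : nat) (f : nat -> nat) (i : nat) :
  (forall j, (K <= j)%N -> f j = 0%N) ->
  tailsum K f i = (f i + tailsum K f i.+1)%N.
Proof.
move=> f0; rewrite /tailsum; have [iK|Ki] := ltnP i K.
  by rewrite big_ltn.
by rewrite f0 // !big_geq // ltnW.
Qed.

Lemma iter_tailsum0 (K s : nat) (f : nat -> nat) (i : nat) :
  (forall j, (K <= j)%N -> f j = 0%N) -> (K <= i)%N ->
  iter s (tailsum K) f i = 0%N.
Proof. by move=> f0; case: s => [|s] Ki /=; [exact: f0|rewrite /tailsum big_geq]. Qed.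

Lemma is_partition_size (n : nat) (l : seq nat) : is_partition n l ->
  (size l <= n)%N.
Proof.
move=> /and3P[_ l1 /eqP <-]; elim: l l1 => //= a l IH /andP[a1 /IH h].
by rewrite -add1n leq_add.
Qed.

Section Multiplicities.
Variables (r K M : nat).
Implicit Type d : {ffun 'I_K -> 'I_M.+1}.

Definition weight d : nat := (\sum_(i < K) 'C(i + r, r) * d i)%N.

Definition mult_ge (m : nat) d : nat := (\sum_(i < K) (m <= d i))%N.

Definition mult d (i : nat) : nat := if insub i is Some j then d j else 0%N.

Lemma mult_ord d (i : 'I_K) : mult d i = d i.
Proof. by rewrite /mult valK. Qed.

Lemma mult0 d (i : nat) : (K <= i)%N -> mult d i = 0%N.
Proof. by move=> Ki; rewrite /mult insubF // ltnNge Ki. Qed.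

(** Inverse of taking r-th differences: r-fold tail sums. For r > 0 they are nonincreasing, so
    cutting at the first zero keeps exactly the positive parts. *)
Definition partition_of d : seq nat :=
  let g := iter r (tailsum K) (mult d) in
  mkseq g (find (fun i => g i == 0%N) (iota 0 K)).

Hypothesis r_gt0 : (0 < r)%N.

Let gpart d := iter r (tailsum K) (mult d).

Lemma gpartS d i : (gpart d i.+1 <= gpart d i)%N.
Proof.
rewrite /gpart; case: r r_gt0 => // s _ /=.
rewrite (@tailsumS _ _ i) ?leq_addl // => j Kj.
by apply: iter_tailsum0 => // k; exact: mult0.
Qed.

Lemma gpart_le d i j : (i <= j)%N -> (gpart d j <= gpart d i)%N.
Proof.
move=> /subnK <-; elim: (j - i)%N => // k IH.
by rewrite addSn (leq_trans (gpartS _ _)).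
Qed.

Lemma nth_partition_of d i : nth 0%N (partition_of d) i = gpart d i.
Proof.
rewrite /partition_of -/(gpart d); set k := find _ _.
have kK : (k <= K)%N by rewrite -[leqRHS](size_iota 0); apply: find_size.
have [ik|ki] := ltnP i k; first by rewrite nth_mkseq.
rewrite nth_default ?size_mkseq //.
apply/esym/eqP; rewrite -leqn0 (leq_trans (gpart_le _ ki)) // leqn0.
have [kltK|Kk] := ltnP k K; last first.
  by rewrite /gpart iter_tailsum0 // => j; exact: mult0.
have : has (fun i => gpart d i == 0%N) (iota 0 K) by rewrite has_find size_iota.
by move/(nth_find 0%N); rewrite -/k nth_iota.
Qed.

Lemma partition_of_gt0 d : all (leq 1) (partition_of d).
Proof.
apply/(all_nthP 0%N) => i; rewrite nth_partition_of size_mkseq => ik.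
rewrite lt0n; move/(before_find 0%N): (ik); rewrite nth_iota ?add0n => [->//|].
by rewrite (leq_trans ik) // -[leqRHS](size_iota 0); apply: find_size.
Qed.

Lemma sorted_partition_of d : sorted geq (partition_of d).
Proof.
apply/(sortedP 0%N) => i _.
by rewrite !nth_partition_of; exact: gpartS.
Qed.

Lemma rdiff_partition_of d i : rdiff (partition_of d) r i.+1 = (mult d i)%:Z.
Proof.
suff H k : (k <= r)%N -> forall i, rdiff (partition_of d) k i.+1 =
    (iter (r - k) (tailsum K) (mult d) i)%:Z by rewrite H // subnn.
elim: k => [_ j|k IH kr j]; first by rewrite /= subn0 nth_partition_of.
rewrite rdiffS !IH ?(ltnW kr) // -(subnSK kr) /=.
rewrite (@tailsumS _ _ j) ?PoszD ?addrK //.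
by move=> a; apply: iter_tailsum0 => b; exact: mult0.
Qed.

Lemma partition_of_inj : injective partition_of.
Proof.
move=> d d' dd'; apply/ffunP => i; apply/val_inj => /=.
rewrite -!mult_ord; have := rdiff_partition_of d i.
by rewrite dd' rdiff_partition_of; case.
Qed.

Lemma size_partition_of d : (size (partition_of d) <= K)%N.
Proof. by rewrite size_mkseq -[leqRHS](size_iota 0); apply: find_size. Qed.

Lemma sumn_partition_of d : sumn (partition_of d) = weight d.
Proof.
have := sum_rdiff r (size_partition_of d).
under eq_bigr do rewrite rdiff_partition_of mult_ord -PoszM.
by rewrite -(big_morph Posz PoszD (erefl _)) => -[].
Qed.

(** A partition of n has at most n parts, hence fits in [K] positions; each coefficient 'C(i + r, r)
    is at least 1, so every r-th difference is at most n and survives the truncation at [M]. *)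
Lemma partition_of_onto n l : diff_partition_set r n l -> (n <= K)%N ->
  (n <= M)%N -> exists2 d, weight d = n & partition_of d = l.
Proof.
move=> [Pl Dl] nK nM; have /and3P[sl l1 /eqP ln] := Pl.
have D0 i : 0 <= rdiff l r i.+1.
  have [il|li] := ltnP i (size l); last by rewrite rdiff_out.
  by apply: Dl; rewrite /indices !inE mem_iota /= add1n ltnS.
have lK : (size l <= K)%N := leq_trans (is_partition_size Pl) nK.
have sumD := sum_rdiff r lK.
have sumDn : (\sum_(i < K) 'C(i + r, r) * `|rdiff l r i.+1|)%N = n.
  apply/eqP; rewrite -eqz_nat -ln -sumD (big_morph Posz PoszD (erefl _)).
  by apply/eqP/eq_bigr => i _; rewrite PoszM gez0_abs.
have Dn (i : 'I_K) : (`|rdiff l r i.+1| <= n)%N.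
  rewrite -sumDn (bigD1 i) //= (leq_trans _ (leq_addr _ _)) //.
  by rewrite leq_pmull // bin_gt0 leq_addl.
pose d : {ffun 'I_K -> 'I_M.+1} := [ffun i : 'I_K => inord `|rdiff l r i.+1|%N].
have dE i : d i = `|rdiff l r i.+1|%N :> nat.
  by rewrite ffunE inordK // ltnS (leq_trans (Dn _)).
have wd : weight d = n by rewrite -[RHS]sumDn; apply: eq_bigr => i _; rewrite dE.
exists d => //; apply: (@rdiff_inj _ _ r (partition_of_gt0 d) l1) => i.
rewrite rdiff_partition_of; have [iK|Ki] := ltnP i K.
  by rewrite (mult_ord d (Ordinal iK)) dE gez0_abs.
by rewrite mult0 // rdiff_out // ltnS (leq_trans lK).
Qed.

Lemma partition_of_diff d : diff_partition_set r (weight d) (partition_of d).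
Proof.
split; first by apply/and3P; rewrite sorted_partition_of partition_of_gt0
  sumn_partition_of.
move=> [|i]; first by rewrite /indices !inE mem_iota.
by rewrite rdiff_partition_of.
Qed.

Lemma num_ge_partition_of m d : (0 < m)%N ->
  num_ge r m (partition_of d) = mult_ge m d.
Proof.
move=> m0; rewrite /num_ge /mult_ge.
have -> : (\sum_(i < K) (m <= d i))%N = (\sum_(i < K) (m <= mult d i))%N.
  by apply: eq_bigr => i _; rewrite mult_ord.
rewrite -(big_mkord xpredT (fun i => (m <= mult d i : nat)%N)).
rewrite -big_mkcond sum1_count -size_filter.
have us : uniq [seq i.+1 | i <- index_iota 0 K & (m <= mult d i)%N].
  by rewrite (map_inj_uniq succn_inj) filter_uniq // iota_uniq.
rewrite -[RHS](size_map S); apply/perm_size/(uniq_perm (fset_uniq _) us) => x.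
rewrite !inE /= mem_iota; apply/idP/mapP.
  case: x => [|i]; first by case/andP.
  rewrite rdiff_partition_of lez_nat => /andP[_ mi]; exists i => //.
  rewrite mem_filter mi mem_iota subn0 /= add0n ltnNge; apply/negP => /(mult0 d) i0.
  by move: mi; rewrite i0 leqNgt m0.
move=> [i]; rewrite mem_filter => /andP[mi _] ->.
rewrite rdiff_partition_of lez_nat mi andbT /= add1n ltnS ltnNge.
apply/negP => si; move: mi; rewrite -lez_nat -rdiff_partition_of rdiff_out //.
by rewrite lez_nat leqNgt m0.
Qed.

Lemma sum_diff_partitions (R : nmodType) n (F : seq nat -> R) :
  (n <= K)%N -> (n <= M)%N ->
  \sum_(l <- diff_partitions r n) F l =
  \sum_(d | weight d == n) F (partition_of d).
Proof.
move=> nK nM; have -> : \sum_(d | weight d == n) F (partition_of d) =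
    \sum_(l <- [seq partition_of d | d <- index_enum _ & weight d == n]) F l.
  by rewrite big_map big_filter.
apply: perm_big; apply: uniq_perm; first exact: fset_uniq.
  by rewrite (map_inj_uniq partition_of_inj) filter_uniq // index_enum_uniq.
move=> l; apply/idP/idP.
  move=> /in_diff_partitions/partition_of_onto /(_ nK nM)[d wd <-].
  by rewrite map_f // mem_filter wd eqxx mem_index_enum.
move=> /mapP[d]; rewrite mem_filter => /andP[/eqP <- _] ->.
exact/in_diff_partitions/partition_of_diff.
Qed.

End Multiplicities.

(* A partition of k <= n is completed to one of n by adding n - k parts 1. *)
Lemma card_weight_le (r K M n : nat) : (0 < K)%N -> (n <= M)%N ->
  (#|[pred d : {ffun 'I_K -> 'I_M.+1} | weight r d <= n]| <=
   n.+1 * #|[pred d : {ffun 'I_K -> 'I_M.+1} | weight r d == n]|)%N.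
Proof.
case: K => // K _ nM; set q := #|[pred d | weight r d == n]|.
rewrite -sum1_card (partition_big (fun d => inord (weight r d) : 'I_n.+1) xpredT) //=.
rewrite -[X in (_ <= X * _)%N]card_ord -sum_nat_const leq_sum // => k _.
rewrite sum1_card.
pose up (d : {ffun 'I_K.+1 -> 'I_M.+1}) : {ffun 'I_K.+1 -> 'I_M.+1} :=
  [ffun i => if i == ord0 then inord (d i + (n - k)) else d i].
have wk d : (weight r d <= n)%N && (inord (weight r d) == k) -> weight r d = k.
  by move=> /andP[wn /eqP <-]; rewrite inordK.
have w0 (d : {ffun 'I_K.+1 -> 'I_M.+1}) : weight r d =
    (d ord0 + \sum_(i < K) 'C(lift ord0 i + r, r) * d (lift ord0 i))%N.
  by rewrite /weight big_ord_recl add0n binn mul1n.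
have up0 d : weight r d = k -> up d ord0 = (d ord0 + (n - k))%N :> nat.
  move=> wdk; rewrite ffunE eqxx inordK // ltnS (leq_trans _ nM) //.
  have dk : (d ord0 <= k)%N by rewrite -wdk w0 leq_addr.
  have := ltn_ord k; lia.
have upw d : weight r d = k -> weight r (up d) = n.
  move=> wdk; rewrite w0 up0 // addnAC.
  have -> : (\sum_(i < K) 'C(lift ord0 i + r, r) * up d (lift ord0 i) =
    \sum_(i < K) 'C(lift ord0 i + r, r) * d (lift ord0 i))%N.
    by apply: eq_bigr => i _; rewrite ffunE.
  by rewrite -w0 wdk subnKC // -ltnS.
rewrite -[leqLHS](@card_in_imset _ _ up).
  apply/subset_leq_card/fintype.subsetP => _ /imsetP[d dk ->].
  by rewrite inE upw // wk.
move=> d d' /wk dk /wk d'k /ffunP eqd; apply/ffunP => i.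
have [->|i0] := eqVneq i ord0; last first.
  by have := eqd i; rewrite !ffunE (negbTE i0).
by apply/val_inj/eqP; rewrite -(eqn_add2r (n - k)) /= -!up0 // eqd.
Qed.

(** * Truncated geometric laws and their products *)

Section TruncatedGeometric.
Variable R : realFieldType.
Implicit Types (y : R) (M k : nat).

(* Law of min(G, M), where P(G >= k) = y^k. *)
Definition tgeom y M k : R := if (k < M)%N then y ^+ k * (1 - y) else y ^+ M.

(** Summation by parts against the tail probabilities y^k, k <= M. The mean, the second moment and
    the generating function below are all instances. *)
Lemma tgeom_sum y M (g : nat -> R) :
  \sum_(k < M.+1) tgeom y M k * g k =
  g 0%N + \sum_(k < M) y ^+ k.+1 * (g k.+1 - g k).
Proof.
elim: M => [|M IH].
  by rewrite big_ord_recl !big_ord0 /tgeom ltnn expr0 mul1r.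
rewrite big_ord_recr big_ord_recr [in RHS]big_ord_recr /= addrA -IH big_ord_recr /=.
have -> : \sum_(i < M) tgeom y M.+1 (widen_ord (leqnSn M.+1) (widen_ord (leqnSn M) i))
    * g i = \sum_(i < M) tgeom y M i * g i.
  by apply: eq_bigr => i _; rewrite /tgeom /= ltnS (ltnW (ltn_ord i)) ltn_ord.
rewrite /tgeom !ltnn ltnSn exprS; ring.
Qed.

Lemma tgeom_sum1 y M : \sum_(k < M.+1) tgeom y M k = 1.
Proof.
have := tgeom_sum y M (fun=> 1); under eq_bigr do rewrite mulr1.
by move->; rewrite big1 ?addr0 // => i _; rewrite subrr mulr0.
Qed.

Lemma tgeom_ge0 y M k : 0 <= y <= 1 -> 0 <= tgeom y M k.
Proof.
move=> /andP[y0 y1]; rewrite /tgeom; case: ifP => _; rewrite ?exprn_ge0 //.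
by rewrite mulr_ge0 ?exprn_ge0 // subr_ge0.
Qed.

Lemma tgeom_mean y M :
  \sum_(k < M.+1) tgeom y M k * k%:R = \sum_(k < M) y ^+ k.+1.
Proof.
rewrite (tgeom_sum y M (fun k => k%:R)) add0r; apply: eq_bigr => k _.
by rewrite -natrB // subSnn mulr1.
Qed.

Lemma sum_geom y M : (1 - y) * \sum_(k < M) y ^+ k.+1 = y * (1 - y ^+ M).
Proof.
elim: M => [|M IH]; first by rewrite big_ord0 expr0 subrr !mulr0.
by rewrite big_ord_recr /= mulrDr IH exprS; ring.
Qed.

(** Without truncation the second moment is y (1 + y) / (1 - y)^2, and truncation lowers it.
    Multiplying out avoids dividing by 1 - y. *)
Lemma tgeom_sqr y M : 0 <= y <= 1 ->
  (1 - y) ^+ 2 * \sum_(k < M.+1) tgeom y M k * k%:R ^+ 2 <= 2 * y.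
Proof.
move=> /andP[y0 y1]; rewrite (tgeom_sum y M (fun k => k%:R ^+ 2)) expr0n add0r.
(* Exact value, proved by induction on [M]; both subtracted terms are nonnegative. *)
suff -> : (1 - y) ^+ 2 * (\sum_(k < M) y ^+ k.+1 * (k.+1%:R ^+ 2 - k%:R ^+ 2)) =
    2 * y - y * (1 - y) - y ^+ M.+1 * (2 * (M%:R * (1 - y)) + 1 + y).
  have : 0 <= y * (1 - y) by rewrite mulr_ge0 // subr_ge0.
  have : 0 <= y ^+ M.+1 * (2 * (M%:R * (1 - y)) + 1 + y).
    rewrite mulr_ge0 ?exprn_ge0 // !addr_ge0 // mulr_ge0 // mulr_ge0 // subr_ge0 //.
  lra.
elim: M => [|M IH]; first by rewrite big_ord0; ring.
by rewrite big_ord_recr /= mulrDr IH !exprS -natr1; ring.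
Qed.

Lemma tgeom_tail y M m s : (m <= M)%N ->
  \sum_(k < M.+1) tgeom y M k * s ^+ (m <= k)%N =
  1 + (s - 1) * y ^+ m.
Proof.
rewrite (tgeom_sum y M (fun k => s ^+ (m <= k)%N)).
case: m => [_|m mM].
  rewrite big1 => [|i _]; rewrite ?subrr ?mulr0 ?mulr1 ?leq0n //; ring.
rewrite (bigD1 (Ordinal mM)) //= big1 => [|i] /=.
  by rewrite ltnSn ltnn /=; ring.
rewrite -val_eqE /= => im.
have -> : (m < i.+1)%N = (m < i)%N by rewrite ltnS leq_eqVlt eq_sym (negbTE im).
by rewrite subrr mulr0.
Qed.

End TruncatedGeometric.

Section ProductMeasure.
Variables (R : realFieldType) (I J : finType) (p : I -> J -> R).
Hypotheses (p_ge0 : forall i k, 0 <= p i k) (p_sum : forall i, \sum_k p i k = 1).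

Definition prodm (d : {ffun I -> J}) : R := \prod_i p i (d i).

Lemma prodm_ge0 d : 0 <= prodm d.
Proof. by apply: prodr_ge0 => i _. Qed.

Lemma prodm_prod (g : I -> J -> R) :
  \sum_d prodm d * \prod_i g i (d i) = \prod_i \sum_k p i k * g i k.
Proof.
rewrite bigA_distr_bigA; apply: eq_bigr => d _.
by rewrite -big_split.
Qed.

Lemma prodm_sum1 : \sum_d prodm d = 1.
Proof.
transitivity (\sum_d prodm d * \prod_i (fun _ _ => 1) i (d i)).
  by apply: eq_bigr => d _; rewrite big1 ?mulr1.
rewrite (prodm_prod (fun _ _ => 1)); apply: big1 => i _; under eq_bigr do rewrite mulr1.
exact: p_sum.
Qed.

(** Variance of a sum of independent centred variables: the cross terms vanish. *)
Lemma prodm_sqr_sum (g : I -> J -> R) : (forall i, \sum_k p i k * g i k = 0) ->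
  \sum_d prodm d * (\sum_i g i (d i)) ^+ 2 =
  \sum_i \sum_k p i k * g i k ^+ 2.
Proof.
move=> g0.
have cross i j : \sum_d prodm d * (g i (d i) * g j (d j)) =
    if i == j then \sum_k p i k * g i k ^+ 2 else 0.
  (* Writes g_i g_j as a product over all coordinates, so that [prodm_prod] applies; for i = j the
     factor at i is the square. *)
  pose h l k := (if l == i then g i k else 1) * (if l == j then g j k else 1).
  have hE d : \prod_l h l (d l) = g i (d i) * g j (d j).
    by rewrite big_split /= -!big_mkcond /= !big_pred1_eq.
  under eq_bigr do rewrite -hE.
  rewrite (prodm_prod h); have [ij|ij] := eqVneq i j.
    rewrite (bigD1 i) //= [X in _ * X]big1 => [|l li].
      by rewrite mulr1 /h -ij eqxx; apply: eq_bigr => k _; rewrite expr2.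
    by rewrite -[RHS](p_sum l); apply: eq_bigr => k _;
       rewrite /h -ij (negbTE li) !mulr1.
  rewrite (bigD1 i) //= (_ : \sum_k _ = 0) ?mul0r // -[RHS](g0 i).
  by apply: eq_bigr => k _; rewrite /h eqxx (negbTE ij) mulr1.
under eq_bigr do rewrite expr2 big_distrlr /= mulr_sumr.
rewrite exchange_big; apply: eq_bigr => i _ /=.
under eq_bigr do rewrite mulr_sumr.
rewrite exchange_big /= (bigD1 i) //= cross eqxx [X in _ + X]big1 ?addr0 // => j.
by rewrite cross eq_sym => /negbTE ->.
Qed.

(** Markov's inequality, applied with [f] an exponential for Chernoff and a square for Chebyshev. *)
Lemma prodm_markov (A : pred {ffun I -> J}) (f : {ffun I -> J} -> R) (a : R) :
  (forall d, 0 <= f d) -> (forall d, A d -> a <= f d) ->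
  a * \sum_(d | A d) prodm d <= \sum_d prodm d * f d.
Proof.
move=> f0 fA; rewrite mulr_sumr [leRHS](bigID A) /= ler_wpDr //.
  by apply: sumr_ge0 => d _; rewrite mulr_ge0 ?prodm_ge0.
by apply: ler_sum => d Ad; rewrite mulrC ler_wpM2l ?prodm_ge0 ?fA.
Qed.

End ProductMeasure.

(** * Sums of stretched exponentials *)

Section PowerSums.
Variables (R : realType) (r : nat).
Implicit Types (s t : R) (j p q K : nat).

Lemma fact_binS j k :
  (k.+1`! * 'C(j + k.+1, k.+1) = (j + k).+1 * (k`! * 'C(j + k, k)))%N.
Proof.
have := mul_bin_diag (j + k).+1 k; rewrite /= factS addnS => e.
by rewrite mulnAC -e mulnAC mulnA.
Qed.

(** The right side is (j + 1) ... (j + r). With [leq_bin_exp] this sandwiches the binomial between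
    r-th powers whose bases differ by r - 1. *)
Lemma leq_exp_bin j : (j.+1 ^ r <= r`! * 'C(j + r, r))%N.
Proof.
elim: r => [|k IH]; first by rewrite bin0.
by rewrite fact_binS expnS leq_mul // ltnS leq_addr.
Qed.

Lemma leq_bin_exp j : (r`! * 'C(j + r, r) <= (j + r) ^ r)%N.
Proof.
elim: r => [|k IH]; first by rewrite bin0.
rewrite fact_binS expnS addnS leq_mul // (leq_trans IH) //.
by case: k {IH} => // k; rewrite leq_exp2r.
Qed.

Lemma natrM_sum p (c : R) : p%:R * c = \sum_(j < p) c.
Proof. by rewrite sumr_const card_ord mulr_natl. Qed.

(** The p terms lost by the shift are at most 1 each; the terms gained beyond [K] are
    nonnegative. *)
Lemma sum_shift (g : nat -> R) K p : (forall j, 0 <= g j <= 1) ->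
  \sum_(j < K) g j <= p%:R + \sum_(j < K) g (j + p)%N.
Proof.
move=> g01; apply: (@le_trans _ _ (\sum_(j < p + K) g j)).
  by rewrite addnC big_split_ord /= lerDl sumr_ge0 // => j _; case/andP: (g01 (K + j)%N).
rewrite big_split_ord /= lerD //.
  rewrite -[leRHS]mulr1 natrM_sum ler_sum // => j _.
  by case/andP: (g01 j).
by under eq_bigr do rewrite addnC.
Qed.

Definition stretched s j : R := expR (- (s * j%:R ^+ r)).

Definition psum K s : R := \sum_(j < K) stretched s j.+1.

Lemma stretched_ge0 s j : 0 <= stretched s j.
Proof. exact: expR_ge0. Qed.

Lemma stretched_le1 s j : 0 <= s -> stretched s j <= 1.
Proof. by move=> s0; rewrite expR_le1 oppr_le0 mulr_ge0 ?exprn_ge0. Qed.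

Lemma stretched_anti s j p : 0 <= s -> (j <= p)%N -> stretched s p <= stretched s j.
Proof.
move=> s0 jp; rewrite ler_expR lerN2 ler_wpM2l //.
by rewrite lerXn2r ?nnegrE // ler_nat.
Qed.

Lemma stretchedM s j p : stretched (s * p%:R ^+ r) j = stretched s (p * j).
Proof. by rewrite /stretched natrM exprMn mulrA. Qed.

Lemma psum_ge0 K s : 0 <= psum K s.
Proof. by apply: sumr_ge0 => j _; exact: stretched_ge0. Qed.

Lemma psum_anti K s t : s <= t -> psum K t <= psum K s.
Proof.
move=> st; apply: ler_sum => j _.
by rewrite ler_expR lerN2 ler_wpM2r // exprn_ge0.
Qed.

Lemma psum_mono K p s : (K <= p)%N -> psum K s <= psum p s.
Proof.
move=> /subnKC <-; rewrite /psum big_split_ord /= lerDl.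
by apply: sumr_ge0 => j _; exact: stretched_ge0.
Qed.

(** The terms of index pj + 1, ..., pj + p are at least the last one, which by [stretchedM] is term
    j + 1 of the sum at p^r s. *)
Lemma psum_blocks_ge K p s : 0 <= s ->
  p%:R * psum K (s * p%:R ^+ r) <= psum (p * K) s.
Proof.
move=> s0; rewrite /psum; elim: K => [|K IH]; first by rewrite muln0 !big_ord0 mulr0.
rewrite big_ord_recr /= mulrDr mulnSr big_split_ord /= lerD //.
rewrite stretchedM natrM_sum ler_sum // => j _.
by rewrite stretched_anti // mulnSr -addnS leq_add2l.
Qed.

(** Each block is now compared with the term just before it; the first block meets index 0, whence
    the extra 1. *)
Lemma psum_blocks_le K p s : 0 <= s ->
  psum (p * K) s <= p%:R * (1 + psum K (s * p%:R ^+ r)).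
Proof.
move=> s0; apply: (@le_trans _ _ (p%:R * \sum_(j < K) stretched s (p * j))).
  rewrite /psum; elim: K => [|K IH]; first by rewrite muln0 !big_ord0 mulr0.
  rewrite [in leRHS]big_ord_recr /= mulrDr mulnSr big_split_ord /= lerD //.
  rewrite natrM_sum ler_sum // => j _.
  by rewrite stretched_anti // -addnS leq_addr.
rewrite ler_wpM2l //.
have h j : 0 <= stretched s (p * j) <= 1 by rewrite stretched_ge0 stretched_le1.
apply: le_trans (sum_shift K 1 h) _.
by rewrite lerD2l ler_sum // => j _; rewrite stretchedM addn1.
Qed.

(** Here p / q approximates m^(1/r) from below. Both sums are compared with the sum at u = s / q^r,
    in blocks of length p on the left and q on the right. *)
Lemma psum_ratio_le K m p q s : 0 <= s -> (0 < q)%N -> (p ^ r <= m * q ^ r)%N ->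
  p%:R * psum K (m%:R * s) <= q%:R * (1 + psum (p * K) s).
Proof.
move=> s0 q0 pq; have qr0 : 0 < q%:R ^+ r :> R by rewrite exprn_gt0 // ltr0n.
pose u := s / q%:R ^+ r; have u0 : 0 <= u by rewrite divr_ge0 // ltW.
have su : s = u * q%:R ^+ r by rewrite divfK // gt_eqF.
apply: (@le_trans _ _ (p%:R * psum K (u * p%:R ^+ r))).
  rewrite ler_wpM2l // psum_anti // [in leRHS]su mulrCA ler_wpM2l //.
  by rewrite -!natrX -natrM ler_nat.
apply: le_trans (psum_blocks_ge K p u0) _.
apply: (@le_trans _ _ (psum (q * (p * K)) u)); first by rewrite psum_mono // leq_pmull.
by apply: le_trans (psum_blocks_le _ _ u0) _; rewrite -su.
Qed.

(** Mirror image, with p / q above m^(1/r); q <= p lets both sums keep the length [K]. *)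
Lemma psum_ratio_ge K m p q s : 0 <= s -> (0 < q <= p)%N -> (m * q ^ r <= p ^ r)%N ->
  q%:R * psum K s <= p%:R * (1 + psum K (m%:R * s)).
Proof.
move=> s0 /andP[q0 qp] pq; have qr0 : 0 < q%:R ^+ r :> R by rewrite exprn_gt0 // ltr0n.
pose u := s / q%:R ^+ r; have u0 : 0 <= u by rewrite divr_ge0 // ltW.
have su : s = u * q%:R ^+ r by rewrite divfK // gt_eqF.
rewrite [in leLHS]su; apply: le_trans (psum_blocks_ge K q u0) _.
apply: (@le_trans _ _ (psum (p * K) u)); first by rewrite psum_mono // leq_mul2r qp orbT.
apply: le_trans (psum_blocks_le K p u0) _.
rewrite ler_wpM2l // lerD2l psum_anti // su mulrCA ler_wpM2l //.
by rewrite -!natrX -natrM ler_nat.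
Qed.

Hypothesis r_gt0 : (0 < r)%N.

(** Brings the longer sum of [psum_ratio_le] back to length [K]: past [K] each term is at most exp(-
    s K), since j <= j^r. *)
Lemma psum_tail K p s : 0 <= s -> (0 < p)%N ->
  psum (p * K) s <= psum K s + p%:R * K%:R * expR (- (s * K%:R)).
Proof.
move=> s0 p0; have /subnKC <- : (K <= p * K)%N by rewrite leq_pmull.
rewrite /psum big_split_ord /= lerD2l.
apply: (@le_trans _ _ ((p * K - K)%:R * expR (- (s * K%:R)))).
  rewrite natrM_sum ler_sum // => j _.
  rewrite ler_expR lerN2 ler_wpM2l // -natrX ler_nat.
  by rewrite -(prednK r_gt0) expnS (leq_trans _ (leq_pmulr _ _)) ?expn_gt0 // -addnS leq_addr.
by rewrite ler_wpM2r ?expR_ge0 // -natrM ler_nat leq_subr.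
Qed.

(** The sum is at least of order s^(-1/r): if J is least with s (J + 1)^r > 1, its first J terms are
    at least 1/e each, so J + 1 <= e ([psum K s] + 1). *)
Lemma psum_scale K s : 0 < s -> 1 <= s * K%:R ->
  1 <= s * (expR 1 * (psum K s + 1)) ^+ r.
Proof.
move=> s0 sK.
have exJ : exists j, 1 < s * j.+1%:R ^+ r.
  exists K; apply: (le_lt_trans sK); rewrite ltr_pM2l // -natrX ltr_nat.
  by rewrite (leq_trans (ltnSn K)) // -[leqLHS]expn1 leq_pexp2l.
have [J sJ minJ] := ex_minnP exJ.
have JK : (J <= K)%N.
  apply: minJ; apply: (le_lt_trans sK); rewrite ltr_pM2l // -natrX ltr_nat.
  by rewrite (leq_trans (ltnSn K)) // -[leqLHS]expn1 leq_pexp2l.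
have e1 : 1 <= expR 1 :> R by rewrite ltW // expR_gt1.
apply/ltW/(lt_le_trans sJ); rewrite ler_pM2l // lerXn2r ?nnegrE //.
  by rewrite mulr_ge0 ?expR_ge0 // addr_ge0 // psum_ge0.
apply: (@le_trans _ _ (expR 1 * psum J s + 1)); last first.
  rewrite mulrDr mulr1 lerD // ler_wpM2l ?expR_ge0 //; exact: psum_mono.
rewrite -natr1 lerD2r mulr_sumr -[leLHS]mulr1 natrM_sum.
apply: ler_sum => j _; rewrite -expRD -[leLHS]expR0 ler_expR subr_ge0.
rewrite leNgt; apply/negP => /minJ; by rewrite leqNgt ltn_ord.
Qed.

End PowerSums.

(** * Choice of the Boltzmann parameter *)

Section Saddle.
Variables (R : realType) (r : nat).
Hypothesis r_gt0 : (0 < r)%N.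
Implicit Types (t : R) (K M : nat).

Definition psize (i : nat) : R := 'C(i + r, r)%:R.

Definition mu K t : R := \sum_(i < K) expR (- (t * psize i)).

Lemma psize_ge1 i : 1 <= psize i.
Proof. by rewrite ler1n bin_gt0 leq_addl. Qed.

Lemma psize_gt0 i : 0 < psize i.
Proof. exact: lt_le_trans ltr01 (psize_ge1 i). Qed.

Lemma fact_gt0R : 0 < r`!%:R :> R.
Proof. by rewrite ltr0n fact_gt0. Qed.

Lemma mu_ge0 K t : 0 <= mu K t.
Proof. by apply: sumr_ge0 => i _; exact: expR_ge0. Qed.

Lemma mu_le_psum K t : 0 <= t -> mu K t <= psum r K (t / r`!%:R).
Proof.
move=> t0; apply: ler_sum => i _; rewrite ler_expR lerN2 -mulrA ler_wpM2l //.
by rewrite ler_pdivrMl ?fact_gt0R // /psize -natrM -natrX ler_nat leq_exp_bin.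
Qed.

Lemma psum_le_mu K t : 0 <= t -> psum r K (t / r`!%:R) <= mu K t + r%:R.
Proof.
move=> t0; have s0 : 0 <= t / r`!%:R by rewrite divr_ge0.
have h j : 0 <= stretched r (t / r`!%:R) j.+1 <= 1.
  by rewrite stretched_ge0 stretched_le1.
apply: le_trans (sum_shift K r h) _; rewrite addrC lerD2r ler_sum // => i _.
apply: le_trans (stretched_anti r s0 (leqnSn _)) _.
rewrite ler_expR lerN2 -mulrA ler_wpM2l // ler_pdivlMl ?fact_gt0R //.
by rewrite /psize -natrM -natrX ler_nat leq_bin_exp.
Qed.

(** Since t / 2^r <= t / 2, blocks of length 2 suffice. The moment bounds below involve t / 2; this
    returns them to t. *)
Lemma mu_half K t : 0 <= t -> mu K (t / 2) <= 2 * (mu K t + r%:R + 1).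
Proof.
move=> t0; have t20 : 0 <= t / 2 by lra.
apply: le_trans (mu_le_psum K t20) _.
have s0 : 0 <= t / r`!%:R / 2%:R ^+ r by rewrite !divr_ge0 // exprn_ge0.
apply: (@le_trans _ _ (psum r (2 * K) (t / r`!%:R / 2%:R ^+ r))).
  apply: (@le_trans _ _ (psum r K (t / r`!%:R / 2%:R ^+ r))).
    apply: psum_anti; rewrite mulrAC ler_wpM2r ?invr_ge0 // ler_wpM2l //.
    rewrite lef_pV2 ?posrE ?exprn_gt0 // -[leLHS]expr1.
    by rewrite ler_weXn2l // ler1n.
  by rewrite psum_mono // leq_pmull.
apply: le_trans (psum_blocks_le _ _ _ s0) _; rewrite ler_wpM2l //.
rewrite divfK ?gt_eqF ?exprn_gt0 //.
have := psum_le_mu K t0; lra.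
Qed.

Lemma expRN_ge (z : R) : z * expR (- z) <= 1 - expR (- z).
Proof.
have := expR_ge1Dx z; have := expRxMexpNx_1 z; have := expR_gt0 (- z).
nra.
Qed.

(** Half of the exponent is given up to cancel the denominator 1 - exp(- z) of a geometric mean:
    apply [expRN_ge] at z / 2. The next lemma does the same for second moments, at z / 4. *)
Lemma geom_ratio_le (z : R) : 0 <= z ->
  z * expR (- z) <= 2 * expR (- (z / 2)) * (1 - expR (- z)).
Proof.
move=> z0; have := expRN_ge (z / 2).
have -> : expR (- z) = expR (- (z / 2)) ^+ 2.
  by rewrite -expRM_natl; congr expR; field.
have : expR (- (z / 2)) <= 1 by rewrite expR_le1; lra.
have := expR_gt0 (- (z / 2)); set v := expR _ => v0 v1 h.
have : 0 <= v * (1 - v - z / 2 * v) by apply: mulr_ge0; lra.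
have : 0 <= v ^+ 2 * (1 - v) by rewrite mulr_ge0 ?exprn_ge0 //; lra.
nra.
Qed.

Lemma geom_ratio_sqr_le (z : R) : 0 <= z ->
  z ^+ 2 * expR (- z) <= 16 * expR (- (z / 2)) * (1 - expR (- z)) ^+ 2.
Proof.
move=> z0; have := expRN_ge (z / 4).
have -> : expR (- z) = expR (- (z / 4)) ^+ 4.
  by rewrite -expRM_natl; congr expR; field.
have -> : expR (- (z / 2)) = expR (- (z / 4)) ^+ 2.
  by rewrite -expRM_natl; congr expR; field.
have : expR (- (z / 4)) <= 1 by rewrite expR_le1; lra.
have := expR_gt0 (- (z / 4)); set v := expR _ => v0 v1 h.
have h2 : z / 4 * v <= 1 - v ^+ 4.
  apply: (le_trans h); rewrite lerD2l lerN2 exprS ler_piMr ?exprn_ile1 //; lra.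
have zv0 : 0 <= z / 4 * v by rewrite mulr_ge0 //; lra.
have : (z / 4 * v) ^+ 2 <= (1 - v ^+ 4) ^+ 2.
  by rewrite lerXn2r // nnegrE // (le_trans zv0).
rewrite -(ler_pM2l (_ : 0 < 16 * v ^+ 2)); last by rewrite mulr_gt0 ?exprn_gt0.
by apply: le_trans; rewrite le_eqVlt; apply/orP; left; apply/eqP; field.
Qed.

Definition bprob t (i : nat) : R := expR (- (t * psize i)).

Lemma bprob01 t i : 0 <= t -> 0 <= bprob t i <= 1.
Proof.
by move=> t0; rewrite expR_ge0 expR_le1 oppr_le0 mulr_ge0.
Qed.

Lemma bprob_lt1 t i : 0 < t -> bprob t i < 1.
Proof. by move=> t0; rewrite expR_lt1 oppr_lt0 mulr_gt0 // psize_gt0. Qed.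

(** Mean of the weight under the Boltzmann law, by [tgeom_mean]. *)
Definition mean_weight K M t : R :=
  \sum_(i < K) psize i * \sum_(k < M) bprob t i ^+ k.+1.

Lemma mean_weight_le K M t : 0 < t -> t * mean_weight K M t <= 2 * mu K (t / 2).
Proof.
move=> t0; rewrite /mean_weight /mu !mulr_sumr; apply: ler_sum => i _.
have y1 : 0 < 1 - bprob t i by rewrite subr_gt0 bprob_lt1.
have /andP[y0 _] := bprob01 i (ltW t0).
have := sum_geom (bprob t i) M; set S := \sum_(k < M) _ => SE.
rewrite -(ler_pM2r y1) (_ : t * (psize i * S) * (1 - bprob t i) =
  t * psize i * ((1 - bprob t i) * S)); last by ring.
rewrite SE mulrA.
have z0 : 0 <= t * psize i by rewrite mulr_ge0 // ltW.
have := geom_ratio_le z0; rewrite -/(bprob t i).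
have -> : t * psize i / 2 = t / 2 * psize i by field.
apply: le_trans; rewrite ler_piMr ?(mulr_ge0 z0 y0) // lerBlDr lerDl exprn_ge0 //.
Qed.

(** With z = t [psize] i and y = exp(- z), the geometric mean y (1 - y^M) / (1 - y) is bounded below
    using 1 - y <= z and y <= exp(- t). *)
Lemma mean_weight_ge K M t : 0 < t ->
  mu K t * (1 - expR (- (t * M%:R))) <= t * mean_weight K M t.
Proof.
move=> t0; rewrite /mean_weight /mu mulr_sumr mulr_suml; apply: ler_sum => i _.
have y1 : 0 < 1 - bprob t i by rewrite subr_gt0 bprob_lt1.
have /andP[y0 _] := bprob01 i (ltW t0).
have := sum_geom (bprob t i) M; set S := \sum_(k < M) _ => SE.
rewrite -(ler_pM2r y1) (_ : t * (psize i * S) * (1 - bprob t i) =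
  t * psize i * ((1 - bprob t i) * S)); last by ring.
rewrite SE.
rewrite -/(bprob t i) [leRHS]mulrCA -mulrA ler_wpM2l //.
rewrite mulrC; apply: ler_pM; first exact: ltW.
- by rewrite subr_ge0 expR_le1 oppr_le0 mulr_ge0 // ltW.
- have := expR_ge1Dx (- (t * psize i)); rewrite -/(bprob t i); lra.
rewrite lerD2l lerN2 -expRM_natl ler_expR mulrN lerN2 mulrCA (ler_wpM2l (ltW t0)) //.
by rewrite ler_peMr // psize_ge1.
Qed.

Lemma mean_weight_sqr_le K M t : 0 < t ->
  t ^+ 2 * \sum_(i < K) psize i ^+ 2 *
     \sum_(k < M.+1) tgeom (bprob t i) M k * k%:R ^+ 2 <= 32 * mu K (t / 2).
Proof.
move=> t0; rewrite /mu !mulr_sumr; apply: ler_sum => i _.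
have y1 : 0 < 1 - bprob t i by rewrite subr_gt0 bprob_lt1.
set S := \sum_(k < M.+1) _; rewrite -(ler_pM2r (exprn_gt0 2 y1)).
rewrite (_ : t ^+ 2 * (psize i ^+ 2 * S) * (1 - bprob t i) ^+ 2 =
  (t * psize i) ^+ 2 * ((1 - bprob t i) ^+ 2 * S));
  last by ring.
have z0 : 0 <= t * psize i by rewrite mulr_ge0 // ltW.
apply: (@le_trans _ _ ((t * psize i) ^+ 2 * (2 * bprob t i))).
  by rewrite ler_wpM2l ?exprn_ge0 // tgeom_sqr // bprob01 // ltW.
have := geom_ratio_sqr_le z0; rewrite -/(bprob t i).
have -> : t * psize i / 2 = t / 2 * psize i by field.
nra.
Qed.

Lemma continuous_mean_weight K M : continuous (mean_weight K M).
Proof.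
move=> t; rewrite /mean_weight; apply: cvg_big => [|i _]; first exact: add_continuous.
apply: cvgM; first exact: cvg_cst.
apply: cvg_big => [|k _]; first exact: add_continuous.
suff cE : continuous (fun x : R => bprob x i ^+ k.+1) by exact: cE.
have -> : (fun x : R => bprob x i ^+ k.+1) = expR \o (fun x => k.+1%:R * - (x * psize i)).
  by apply/funext => x; rewrite /= expRM_natl.
move=> x; apply: continuous_comp; last exact: continuous_expR.
apply: cvgM; first exact: cvg_cst.
by apply: cvgN; apply: cvgM; [exact: cvg_id|exact: cvg_cst].
Qed.

(* Placing the mean weight slightly below n, rather than at n, makes the typical
   weights completable to n by parts 1. *)
Definition saddle (delta : R) (n : nat) t :=
  [/\ 0 < t, r`!%:R <= t * n%:R & mean_weight n n.+1 t = (1 - delta) * n%:R].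

(** Intermediate value theorem on [r! / n, 4]: the mean weight is at least n at the left end and at
    most n / 2 at the right end. The left end also gives r! <= t n, which [psum_scale] requires for
    s = t / r!. *)
Lemma saddle_exists (delta : R) : 0 <= delta <= 1 / 2 ->
  exists N, forall n, (N <= n)%N -> exists t, saddle delta n t.
Proof.
move=> /andP[d0 d1].
pose J := (Num.trunc (2 * r`!%:R * expR 1 : R)).+1.
have JA : 2 * r`!%:R * expR 1 <= J%:R :> R by apply/ltW/truncnS_gt.
exists (r`! + J + \sum_(i < J) r`! * 'C(i + r, r))%N => n nN.
have A1 : 1 <= r`!%:R :> R by rewrite ler1n fact_gt0.
have An : r`!%:R <= n%:R :> R by rewrite ler_nat; apply: leq_trans nN; rewrite -addnA leq_addr.
have n0 : 0 < n%:R :> R by lra.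
pose a : R := r`!%:R / n%:R.
have a0 : 0 < a by rewrite divr_gt0 //; lra.
have an : a * n%:R = r`!%:R by rewrite divfK // gt_eqF.
have a4 : a <= 4 by rewrite ler_pdivrMr //; lra.
have fa : n%:R <= mean_weight n n.+1 a.
  rewrite -(ler_pM2l a0); apply: le_trans (mean_weight_ge _ _ a0).
  (* For i < J the choice of n makes a [psize] i <= 1, so J terms are at least 1/e. The factor 2
     pays for the bound 1/2 in [e2]. *)
  have muJ : 2 * r`!%:R <= mu n a.
    rewrite -(ler_pM2r (expR_gt0 1)); apply: (le_trans JA).
    have JN : (J <= n)%N by lia.
    apply: (@le_trans _ _ (mu J a * expR 1)); last first.
      rewrite ler_wpM2r ?expR_ge0 // -(subnKC JN) /mu big_split_ord /= lerDl.
      by apply: sumr_ge0 => i _; exact: expR_ge0.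
    rewrite /mu mulr_suml -[leLHS]mulr1 natrM_sum; apply: ler_sum => i _.
    rewrite -expRD -[leLHS]expR0 ler_expR addrC subr_ge0 mulrAC ler_pdivrMr // mul1r.
    rewrite -natrM ler_nat (leq_trans _ nN) // (leq_trans _ (leq_addl _ _)) //.
    by rewrite (bigD1 i) //= leq_addr.
  have e2 : 1 / 2 <= 1 - expR (- (a * n.+1%:R)).
    have : expR (- (a * n.+1%:R)) <= expR (- 1).
      by rewrite ler_expR lerN2 -natr1 mulrDr an; lra.
    have := expR_ge1Dx (1 : R); have := expRxMexpNx_1 (1 : R).
    have := expR_gt0 (- 1 : R); nra.
  rewrite an; nra.
have fb : mean_weight n n.+1 4 <= 1 / 2 * n%:R.
  have := mean_weight_le n n.+1 (_ : 0 < 4 :> R); rewrite ltr0n => /(_ isT).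
  have : mu n (4 / 2) <= n%:R.
    rewrite -[leRHS]mulr1 [leRHS]natrM_sum; apply: ler_sum => i _.
    by rewrite expR_le1 oppr_le0 mulr_ge0.
  lra.
have [t /itvP ta ft] : exists2 t, t \in `[a, 4] & mean_weight n n.+1 t = (1 - delta) * n%:R.
  apply: IVT => //.
    by apply: continuous_subspaceT; exact: continuous_mean_weight.
  rewrite ge_min le_max; apply/andP; split; apply/orP; [right|left].
    by apply: (le_trans fb); rewrite ler_wpM2r //; lra.
  by apply: le_trans fa; rewrite ler_piMl //; lra.
exists t; split=> //; first by apply: lt_le_trans a0 _; rewrite ta.
by rewrite -an ler_pM2r // ta.
Qed.

(** [mu] with the additive constants of [mu_half] and [psum_le_mu] absorbed. *)
Definition nu (n : nat) t : R := mu n t + r%:R + 1.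

(** The first two bounds say that t n has the order of [mu]. With [psum_scale], they make n at most
    polynomial in [nu], so that exponentials in [nu] beat powers of n. *)
Lemma saddle_bounds (delta : R) n t : 0 <= delta <= 1 / 2 -> saddle delta n t ->
  [/\ mu n t <= 2 * (t * n%:R), t * n%:R <= 8 * nu n t &
      n%:R <= 8 * expR 1 ^+ r * nu n t ^+ r.+1].
Proof.
move=> /andP[d0 d1] [t0 tn ft].
have A1 : 1 <= r`!%:R :> R by rewrite ler1n fact_gt0.
have mu0 := mu_ge0 n t.
have n0 : 0 <= n%:R :> R by [].
have tn8 : t * n%:R <= 8 * nu n t.
  have := mean_weight_le n n.+1 t0; have := mu_half n (ltW t0); rewrite ft /nu.
  have : 0 <= t * n%:R * (1 / 2 - delta) by rewrite mulr_ge0 //; lra.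
  nra.
split=> //.
  have := mean_weight_ge n n.+1 t0; rewrite ft.
  have e2 : 1 / 2 <= 1 - expR (- (t * n.+1%:R)).
    have : expR (- (t * n.+1%:R)) <= expR (- 1).
      by rewrite ler_expR lerN2 -natr1 mulrDr; lra.
    have := expR_ge1Dx (1 : R); have := expRxMexpNx_1 (1 : R).
    have := expR_gt0 (- 1 : R); nra.
  have : 0 <= t * n%:R * delta by rewrite mulr_ge0 //; lra.
  nra.
pose s := t / r`!%:R; have s0 : 0 < s by rewrite divr_gt0 //; lra.
have sn : 1 <= s * n%:R by rewrite mulrAC ler_pdivlMr ?mul1r //; lra.
have nu1 : psum r n s + 1 <= nu n t by rewrite lerD2r psum_le_mu // ltW.
have p0 := psum_ge0 r n s.
have h : 1 <= t * (expR 1 * nu n t) ^+ r.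
  apply: (le_trans (psum_scale r_gt0 s0 sn)); apply: ler_pM; first exact: ltW.
  - by rewrite exprn_ge0 // mulr_ge0 ?expR_ge0 //; lra.
  - by rewrite ler_pdivrMr ?ler_peMr //; lra.
  by rewrite lerXn2r ?nnegrE ?mulr_ge0 ?ler_wpM2l ?expR_ge0 //; lra.
rewrite exprMn in h; set X := _ ^+ r in h *; set Y := _ ^+ r in h.
rewrite exprS -/Y.
have X0 : 0 <= X by rewrite exprn_ge0 // expR_ge0.
have Y0 : 0 <= Y by rewrite exprn_ge0 //; lra.
apply: (@le_trans _ _ (n%:R * (t * (X * Y)))); first by rewrite ler_peMr.
rewrite (_ : n%:R * _ = t * n%:R * (X * Y)); last by ring.
rewrite (_ : 8 * X * _ = 8 * nu n t * (X * Y)); last by ring.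
by rewrite ler_wpM2r // mulr_ge0.
Qed.

End Saddle.

(** * Concentration and conditioning *)

Section Boltzmann.
Variables (R : realType) (r K M : nat) (t : R).
Hypothesis t_gt0 : 0 < t.
Local Notation config := {ffun 'I_K -> 'I_M.+1}.
Implicit Types (d : config) (m n : nat).

Let p (i : 'I_K) (k : 'I_M.+1) : R := tgeom (bprob r t i) M k.

Definition boltzmann d : R := prodm p d.

Lemma boltz_p_ge0 i k : 0 <= p i k.
Proof. by rewrite tgeom_ge0 // bprob01 // ltW. Qed.

Lemma boltz_p_sum i : \sum_k p i k = 1.
Proof. exact: tgeom_sum1. Qed.

Lemma boltzmann_ge0 d : 0 <= boltzmann d.
Proof. by apply: prodm_ge0; exact: boltz_p_ge0. Qed.

Lemma boltzmann_sum : \sum_d boltzmann d = 1.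
Proof. by apply: prodm_sum1; exact: boltz_p_sum. Qed.

Lemma boltzmann_markov (A : pred config) (f : config -> R) (a : R) :
  (forall d, 0 <= f d) -> (forall d, A d -> a <= f d) ->
  a * \sum_(d | A d) boltzmann d <= \sum_d boltzmann d * f d.
Proof. by apply: prodm_markov; exact: boltz_p_ge0. Qed.

(** Normalising constant: the reciprocal of the generating function of the weights at exp(- t). *)
Definition partition_fun : R := \prod_(i < K) (1 - bprob r t i).

Lemma partition_fun_ge0 : 0 <= partition_fun.
Proof. by apply: prodr_ge0 => i _; rewrite subr_ge0 ltW // bprob_lt1. Qed.

(** Below weight [M] no coordinate reaches the truncation, so the mass depends on the weight alone:
    conditioning on the weight gives the uniform law. *)
Lemma boltzmannE d : (weight r d < M)%N ->
  boltzmann d = partition_fun * expR (- (t * (weight r d)%:R)).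
Proof.
move=> dM; rewrite /weight natr_sum mulr_sumr -sumrN expR_sum -big_split /=.
apply: eq_bigr => i _; rewrite /p /tgeom ifT; last first.
  apply: leq_ltn_trans dM; rewrite /weight (bigD1 i) //=.
  by rewrite (leq_trans _ (leq_addr _ _)) // leq_pmull // bin_gt0 leq_addl.
rewrite mulrC; congr (_ * _); rewrite -expRM_natr /psize natrM; congr expR.
by rewrite mulNr mulrA.
Qed.

(** [mult_ge m] is a sum of independent Bernoulli variables with means exp(- m t b_i); each factor 1
    + (exp(eta) - 1) y is bounded by an exponential. *)
Lemma mult_ge_mgf m (eta : R) : (m <= M)%N -> `|eta| <= 1 / 2 ->
  \sum_d boltzmann d * expR (eta * (mult_ge m d)%:R) <=
  expR ((eta + 2 * eta ^+ 2) * mu r K (m%:R * t)).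
Proof.
move=> mM etal.
have -> : \sum_d boltzmann d * expR (eta * (mult_ge m d)%:R) =
    \prod_i \sum_k p i k * expR eta ^+ (m <= k)%N.
  rewrite -(prodm_prod _ (fun i (k : 'I_M.+1) => expR eta ^+ (m <= k)%N)).
  apply: eq_bigr => d _; congr (_ * _).
  by rewrite /mult_ge natr_sum mulr_sumr expR_sum; apply: eq_bigr => i _; rewrite expRM_natr.
rewrite /mu mulr_sumr expR_sum; apply: ler_prod => i _.
rewrite tgeom_tail // /bprob -expRM_natl mulrN mulrA; set y := expR (- _).
have y0 : 0 <= y by exact: expR_ge0.
have y1 : y <= 1 by rewrite expR_le1 oppr_le0 !mulr_ge0 // ltW.
have e0 := expR_gt0 eta.
apply/andP; split; first by nra.
(* From exp(- eta) >= 1 - eta, as (1 - eta)(1 + eta + 2 eta^2) = 1 + eta^2 (1 - 2 eta) >= 1. *)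
have : expR eta <= 1 + eta + 2 * eta ^+ 2.
  have := expR_ge1Dx (- eta); have := expRxMexpNx_1 eta.
  have /andP[] : - (1 / 2) <= eta <= 1 / 2 by rewrite -ler_norml.
  move=> l1 l2 h1 h2.
  have : 0 <= eta ^+ 2 * (1 - 2 * eta) by rewrite mulr_ge0 ?sqr_ge0 //; lra.
  nra.
have := expR_ge1Dx ((eta + 2 * eta ^+ 2) * y); nra.
Qed.

Lemma mult_ge_chernoff m (eta x : R) (A : pred config) :
  (m <= M)%N -> `|eta| <= 1 / 2 ->
  (forall d, A d -> eta * x <= eta * (mult_ge m d)%:R) ->
  \sum_(d | A d) boltzmann d <=
  expR ((eta + 2 * eta ^+ 2) * mu r K (m%:R * t) - eta * x).
Proof.
move=> mM etal hA; rewrite -(ler_pM2l (expR_gt0 (eta * x))) -expRD subrKC.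
apply: le_trans (mult_ge_mgf mM etal).
apply: boltzmann_markov => d; first exact: expR_ge0.
move=> Ad; by rewrite ler_expR hA.
Qed.

Lemma mult_ge_concentration m (eps : R) : (m <= M)%N -> 0 <= eps <= 1 ->
  \sum_(d | eps * mu r K (m%:R * t) < `|(mult_ge m d)%:R - mu r K (m%:R * t)|)
    boltzmann d <= 2 * expR (- (eps ^+ 2 / 8 * mu r K (m%:R * t))).
Proof.
move=> mM /andP[e0 e1]; set x := mu _ _ _.
pose A1 d := (1 + eps) * x <= (mult_ge m d)%:R.
pose A2 d := (mult_ge m d)%:R <= (1 - eps) * x.
apply: (@le_trans _ _ (\sum_(d | A1 d) boltzmann d + \sum_(d | A2 d) boltzmann d)).
  rewrite big_mkcond [X in _ <= X + _]big_mkcond [X in _ <= _ + X]big_mkcond -big_split.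
  apply: ler_sum => d _ /=; have P0 := boltzmann_ge0 d.
  case: ifP => [|_]; last by rewrite addr_ge0 //; case: ifP.
  rewrite lter_normr => /orP[h|h].
    by rewrite ifT /A1; [rewrite lerDl; case: ifP|lra].
  by rewrite [X in _ <= _ + X]ifT /A2; [rewrite lerDr; case: ifP|lra].
(* Chernoff with eta = eps / 4 for the upper tail and eta = - eps / 4 for the lower one; both
   exponents equal - eps^2 x / 8. *)
have -> : 2 * expR (- (eps ^+ 2 / 8 * x)) =
    expR ((eps / 4 + 2 * (eps / 4) ^+ 2) * x - eps / 4 * ((1 + eps) * x)) +
    expR ((- (eps / 4) + 2 * (- (eps / 4)) ^+ 2) * x - - (eps / 4) * ((1 - eps) * x)).
  rewrite mulr_natl mulr2n; congr (expR _ + expR _); by field.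
apply: lerD; apply: mult_ge_chernoff => //; rewrite ?normrN ?ger0_norm; try lra.
  by move=> d; rewrite /A1 => h; rewrite ler_wpM2l //; lra.
by move=> d; rewrite /A2 => h; rewrite !mulNr lerN2 ler_wpM2l //; lra.
Qed.

Lemma weight_variance :
  t ^+ 2 * \sum_d boltzmann d * ((weight r d)%:R - mean_weight r K M t) ^+ 2 <=
  32 * mu r K (t / 2).
Proof.
apply: le_trans (mean_weight_sqr_le r K M t_gt0); rewrite ler_pM2l ?exprn_gt0 //.
pose e (i : 'I_K) : R := \sum_(k < M) bprob r t i ^+ k.+1.
pose g (i : 'I_K) (k : 'I_M.+1) : R := psize R r i * (k%:R - e i).
have pg i : \sum_k p i k * g i k = 0.
  under eq_bigr do rewrite mulrCA; rewrite -mulr_sumr.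
  under eq_bigr do rewrite mulrBr; rewrite sumrB -mulr_suml boltz_p_sum.
  by rewrite /p tgeom_mean mul1r subrr mulr0.
have -> : \sum_d boltzmann d * ((weight r d)%:R - mean_weight r K M t) ^+ 2 =
    \sum_d prodm p d * (\sum_i g i (d i)) ^+ 2.
  apply: eq_bigr => d _; congr (_ * _ ^+ 2).
  rewrite /weight natr_sum /mean_weight -sumrB; apply: eq_bigr => i _.
  by rewrite natrM /g mulrBr.
rewrite (prodm_sqr_sum boltz_p_sum pg); apply: ler_sum => i _.
under eq_bigr do rewrite exprMn mulrCA; rewrite -mulr_sumr ler_wpM2l ?sqr_ge0 //.
have -> : \sum_k p i k * (k%:R - e i) ^+ 2 = \sum_k p i k * k%:R ^+ 2 - e i ^+ 2.
  transitivity (\sum_k (p i k * k%:R ^+ 2 - 2 * e i * (p i k * k%:R) + e i ^+ 2 * p i k)).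
    by apply: eq_bigr => k _; ring.
  rewrite big_split sumrB /= -!mulr_sumr boltz_p_sum /p tgeom_mean -/(e i); ring.
by rewrite lerBlDr lerDl sqr_ge0.
Qed.

End Boltzmann.

Section Conditioning.
Variables (R : realType) (r n : nat) (t delta : R).
Hypotheses (r_gt0 : (0 < r)%N) (n_gt0 : (0 < n)%N).
Hypotheses (delta01 : 0 < delta <= 1 / 2) (sd : saddle r delta n t).
Hypothesis nu_small : 512 * nu r n t <= delta ^+ 2 * mu r n t ^+ 2.
Local Notation config := {ffun 'I_n -> 'I_n.+2}.
Implicit Type d : config.

(** Chebyshev: both edges of the window lie delta n away from the mean (1 - delta) n. The variance
    is at most 64 [nu] / t^2 and [mu] <= 2 t n, so the constant 512 = 64 * 4 * 2 leaves probability
    at most 1/2 outside. *)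
Lemma saddle_window :
  1 / 2 <= \sum_(d : config | (weight r d <= n)%N && ((1 - 2 * delta) * n%:R <= (weight r d)%:R))
    boltzmann r t d.
Proof.
have [t0 _ EN] := sd; have /andP[d0 d1] := delta01.
have d01 : 0 <= delta <= 1 / 2 by rewrite ltW.
have [mutn _ _] := saddle_bounds r_gt0 d01 sd.
have nR : 0 < n%:R :> R by rewrite ltr0n.
set W := (X in \sum_(d | X d) _).
have := boltzmann_sum r n n.+1 t; rewrite (bigID W) /=.
suff : \sum_(d | ~~ W d) boltzmann r t d <= 1 / 2 by move=> ? ?; lra.
set S := \sum_(d | _) _.
have S0 : 0 <= S by apply: sumr_ge0 => d _; exact: boltzmann_ge0.
have var := weight_variance r n n.+1 t0.
have half := mu_half r_gt0 n (ltW t0); rewrite -/(nu r n t) in half.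
have : (delta * n%:R) ^+ 2 * S <=
    \sum_(d : config) boltzmann r t d * ((weight r d)%:R - mean_weight r n n.+1 t) ^+ 2.
  apply: (boltzmann_markov r t0) => // d; first exact: sqr_ge0.
  move=> Wd;   rewrite EN; rewrite /W negb_and -ltnNge -ltNge in Wd.
  have dn : 0 <= delta * n%:R by rewrite mulr_ge0 // ltW.
  case/orP: Wd => [|Wd].
    rewrite -(ltr_nat R) => Wd.
    by rewrite lerXn2r ?nnegrE //; lra.
  by rewrite -[leRHS]sqrrN lerXn2r ?nnegrE //; lra.
rewrite -(ler_pM2l (exprn_gt0 2 t0)) => /le_trans/(_ var)/le_trans/(_ _)-/(_ (64 * nu r n t)) h.
have {}h : t ^+ 2 * ((delta * n%:R) ^+ 2 * S) <= 64 * nu r n t by apply: h; lra.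
have mu0 := mu_ge0 r n t.
have mu2 : mu r n t ^+ 2 <= (2 * (t * n%:R)) ^+ 2 by rewrite lerXn2r // nnegrE; lra.
have nu0 : 0 < nu r n t by rewrite ltr_wpDl // addr_ge0.
rewrite leNgt; apply/negP => S2.
have d2 : 0 <= delta ^+ 2 by exact: sqr_ge0.
have := ler_wpM2l d2 mu2.
have -> : delta ^+ 2 * (2 * (t * n%:R)) ^+ 2 = 4 * (t ^+ 2 * (delta * n%:R) ^+ 2) by ring.
move: h nu_small; rewrite mulrA; set X := _ ^+ 2 * (_ * _) ^+ 2; set Y := _ * _ ^+ 2.
move=> h nuY YX; have X0 : 0 < X by lra.
by move: S2; rewrite -(ltr_pM2l X0) => S2; lra.
Qed.

(** With E the mass of a configuration of weight n, the count on the left times E is at most the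
    probability of B. A configuration in the window has mass at most E exp(2 delta t n), and
    [card_weight_le] bounds their number, so [saddle_window] bounds E from below. *)
Lemma saddle_conditioning (B : pred config) :
  (#|[pred d : config | (weight r d == n) && B d]|%:R : R) <=
  2 * n.+1%:R * expR (16 * delta * nu r n t) *
    #|[pred d : config | weight r d == n]|%:R * \sum_(d | B d) boltzmann r t d.
Proof.
have [t0 _ EN] := sd; have /andP[d0 d1] := delta01.
have d01 : 0 <= delta <= 1 / 2 by rewrite ltW.
have [_ tn _] := saddle_bounds r_gt0 d01 sd.
set q := #|[pred d | _ == _]|; set qB := #|_|.
set E : R := partition_fun r n t * expR (- (t * n%:R)).
have G0 := partition_fun_ge0 r n t0.
have E0 : 0 <= E by rewrite mulr_ge0 ?expR_ge0.
have qBE : qB%:R * E <= \sum_(d | B d) boltzmann r t d.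
  rewrite /qB -sum1_card natr_sum mulr_suml [leRHS](bigID (fun d => weight r d == n)) /=.
  rewrite ler_wpDr //; first by apply: sumr_ge0 => d _; exact: boltzmann_ge0.
  rewrite (eq_bigl (fun d => B d && (weight r d == n))); last by move=> d; rewrite inE andbC.
  apply: ler_sum => d /andP[_ /eqP wd].
  by rewrite mul1r boltzmannE // wd.
have qE : 1 / 2 <= n.+1%:R * q%:R * (E * expR (16 * delta * nu r n t)).
  apply: (le_trans saddle_window).
  apply: (@le_trans _ _ (\sum_(d : config | (weight r d <= n)%N) E * expR (16 * delta * nu r n t))).
    rewrite [leLHS]big_mkcond [leRHS]big_mkcond; apply: ler_sum => d _.
    case: (boolP (weight r d <= n)%N) => //= wn; case: ifP => [wd|_]; last first.
      by rewrite mulr_ge0 ?expR_ge0.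
    rewrite boltzmannE // /E -mulrA ler_wpM2l // -expRD ler_expR.
    have : t * ((1 - 2 * delta) * n%:R) <= t * (weight r d)%:R by rewrite ler_pM2l.
    have := ler_wpM2l (ltW d0) tn.
    lra.
  rewrite sumr_const -[leLHS]mulr_natl; apply: ler_wpM2r; first by rewrite mulr_ge0 ?expR_ge0.
  rewrite -natrM ler_nat; exact: card_weight_le.
apply: (@le_trans _ _ (qB%:R * (2 * (n.+1%:R * q%:R * (E * expR (16 * delta * nu r n t)))))).
  by rewrite ler_peMr //; lra.
set F := expR _; rewrite (_ : _ * (2 * _) = 2 * n.+1%:R * F * q%:R * (qB%:R * E)); last by ring.
by apply: ler_wpM2l => //; rewrite !mulr_ge0 // expR_ge0.
Qed.

End Conditioning.

(** * Asymptotics *)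

Section Asymptotics.
Variables (R : realType) (r : nat).
Hypothesis r_gt0 : (0 < r)%N.

Lemma expR_beats_pow (k : nat) (C kappa eta : R) : 0 <= C -> 0 < kappa -> 0 < eta ->
  exists V, forall x, V <= x -> C * x ^+ k * expR (- (kappa * x)) <= eta.
Proof.
move=> C0 kap0 eta0; pose D := C * k.+1`!%:R / kappa ^+ k.+1.
have D0 : 0 <= D by rewrite divr_ge0 ?mulr_ge0 // exprn_ge0 // ltW.
exists (1 + D / eta) => x Vx.
have De : 0 <= D / eta by rewrite divr_ge0 // ltW.
have x0 : 0 < x by lra.
have f0 : 0 < k.+1`!%:R :> R by rewrite ltr0n fact_gt0.
have kx0 : 0 < kappa * x by rewrite mulr_gt0.
have kk : 0 < kappa ^+ k.+1 by rewrite exprn_gt0.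
have e0 := expR_gt0 (kappa * x).
rewrite expRN -ler_pdivlMr ?invr_gt0 // invrK.
apply: (@le_trans _ _ (eta * ((kappa * x) ^+ k.+1 / k.+1`!%:R))); last first.
  by rewrite ler_pM2l //; have := expR_ge1Dxn k (ltW kx0); lra.
rewrite mulrA ler_pdivlMr // exprMn [x ^+ k.+1]exprS.
have -> : C * x ^+ k * k.+1`!%:R = D * kappa ^+ k.+1 * x ^+ k.
  by rewrite /D divfK ?gt_eqF // mulrAC.
rewrite (_ : eta * _ = eta * x * kappa ^+ k.+1 * x ^+ k); last by ring.
rewrite !ler_wpM2r ?exprn_ge0 ?(ltW x0) ?(ltW kap0) //.
by rewrite -ler_pdivrMl // mulrC; lra.
Qed.

(** By the last bound of [saddle_bounds], a bounded [nu] would bound n. *)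
Lemma nu_large (delta V : R) : 0 <= delta <= 1 / 2 ->
  exists N, forall n t, (N <= n)%N -> saddle r delta n t -> V <= nu r n t.
Proof.
move=> d01; pose W := `|V|; have VW : V <= W by exact: ler_norm.
have W0 : 0 <= W by exact: normr_ge0.
pose B : R := 8 * expR 1 ^+ r * W ^+ r.+1.
exists (Num.trunc B).+1 => n t Nn sd.
have [_ _ nb] := saddle_bounds r_gt0 d01 sd.
have nu0 : 0 <= nu r n t by rewrite !addr_ge0 // mu_ge0.
apply: (le_trans VW); rewrite leNgt; apply/negP => nuW.
have : n%:R <= B.
  apply: (le_trans nb); rewrite ler_wpM2l ?mulr_ge0 ?exprn_ge0 ?expR_ge0 //.
  by rewrite lerXn2r ?nnegrE // ltW.
rewrite leNgt => /negP; apply; apply: (lt_le_trans (truncnS_gt B)).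
by rewrite ler_nat.
Qed.

Lemma mu_ratio (m : nat) (c eps : R) : (0 < m)%N -> 0 < c <= 1 ->
  c ^+ r * m%:R = 1 -> 0 < eps <= 1 ->
  exists V, forall (delta : R) n t, 0 <= delta <= 1 / 2 -> saddle r delta n t ->
    V <= nu r n t -> `|mu r n (m%:R * t) - c * mu r n t| <= eps * mu r n t.
Proof.
move=> m0 /andP[c0 c1] cm /andP[e0 e1].
(* q / p <= c < (q + 1) / p with 1 / p <= eps / 2: the pairs (p, q) and (p, q + 1) serve the lower
   and the upper bound. *)
pose p := (Num.trunc (2 / eps)).+1; pose q := Num.trunc (c * p%:R).
have pe : 2 / eps <= p%:R by apply/ltW/truncnS_gt.
have p0 : 0 < p%:R :> R by rewrite ltr0n.
have pe2 : 1 <= eps / 2 * p%:R by move: pe; rewrite ler_pdivrMr //; lra.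
have cp0 : 0 <= c * p%:R by rewrite mulr_ge0 // ltW.
have /andP[qc cq] : q%:R <= c * p%:R < q.+1%:R by exact: truncn_itv.
have qp : (q <= p)%N.
  by rewrite -(ler_nat R) (le_trans qc) // ler_piMl // ltW.
have pr : (c * p%:R) ^+ r * m%:R = p%:R ^+ r by rewrite exprMn mulrAC cm mul1r.
have mq : (m * q ^ r <= p ^ r)%N.
  rewrite -(ler_nat R) natrM !natrX -pr mulrC ler_wpM2r //.
  by rewrite lerXn2r ?nnegrE.
have mq1 : (p ^ r <= m * q.+1 ^ r)%N.
  rewrite -(ler_nat R) natrM !natrX -pr mulrC ler_wpM2l //.
  by rewrite lerXn2r ?nnegrE // ltW.
pose f : R := r`!%:R; have f1 : 1 <= f by rewrite ler1n fact_gt0.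
have C0 : 0 <= p%:R * (8 * expR 1 ^+ r) :> R.
  by rewrite !mulr_ge0 // exprn_ge0 // expR_ge0.
have k0 : 0 < (4 * f)^-1 by rewrite invr_gt0; lra.
have [V1 hV1] := expR_beats_pow r.+1 C0 k0 (@ltr01 R).
(* [V1] makes the tail of [psum_tail] at most 1; the other threshold absorbs the additive constants
   into eps [mu]. *)
exists (Num.max V1 (8 * (r%:R + 2) / eps)) => delta n t d01 sd.
rewrite ge_max => /andP[nu1 nu2].
have [mutn tn nb] := saddle_bounds r_gt0 d01 sd; have [t0 _ _] := sd.
set x := mu r n t in mutn *; set y := mu r n (m%:R * t).
have nuE : nu r n t = x + r%:R + 1 by [].
have r1 : 1 <= r%:R :> R by rewrite ler1n.
have {nu2} xe : 4 * (r%:R + 2) <= eps * x.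
  move: nu2; rewrite ler_pdivrMr // nuE => nu2.
  have : eps * (r%:R + 1) <= 1 * (r%:R + 1) by rewrite ler_wpM2r //; lra.
  lra.
have x0 : 0 <= x by exact: mu_ge0.
have ex : eps * x <= x by rewrite ler_piMl.
pose s := t / f; have s0 : 0 < s by rewrite divr_gt0 //; lra.
have mt0 : 0 <= m%:R * t by rewrite mulr_ge0 // ltW.
have yU : y <= psum r n (m%:R * s) by rewrite mulrA; exact: mu_le_psum.
have Uy : psum r n (m%:R * s) <= y + r%:R by rewrite mulrA; exact: psum_le_mu.
have xU : x <= psum r n s by apply: mu_le_psum; exact: ltW.
have Ux : psum r n s <= x + r%:R by apply: psum_le_mu; exact: ltW.
have lo : (c * p%:R - 1) * x <= p%:R * (1 + r%:R + y).
  apply: (@le_trans _ _ (q%:R * psum r n s)).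
    apply: (@le_trans _ _ (q%:R * x)); last by rewrite ler_wpM2l.
    by rewrite ler_wpM2r // lerBlDr natr1 ltW.
  have [->|q0] := posnP q.
    by rewrite mul0r mulr_ge0 ?addr_ge0 // mu_ge0.
  have := psum_ratio_ge n (ltW s0) (_ : (0 < q <= p)%N) mq; rewrite q0 => /(_ qp) h.
  apply: (le_trans h); rewrite ler_wpM2l //; lra.
have tail : p%:R * n%:R * expR (- (s * n%:R)) <= 1.
  apply: le_trans (hV1 _ nu1); apply: ler_pM; rewrite ?expR_ge0 ?mulr_ge0 //.
    by rewrite -mulrA ler_wpM2l.
  rewrite ler_expR lerN2 /s mulrAC -/f ler_pdivlMr; last by lra.
  have -> : (4 * f)^-1 * nu r n t * f = nu r n t / 4.
    by field; rewrite gt_eqF //; lra.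
  rewrite nuE; lra.
have hi : p%:R * y <= (c * p%:R + 1) * (x + r%:R + 2).
  apply: (@le_trans _ _ (p%:R * psum r n (m%:R * s))); first by rewrite ler_wpM2l.
  apply: le_trans (psum_ratio_le n (ltW s0) (ltn0Sn q) mq1) _.
  apply: ler_pM => //; first by rewrite addr_ge0 // psum_ge0.
    by rewrite -natr1 lerD2r.
  have := psum_tail r_gt0 n (ltW s0) (ltn0Sn _ : (0 < p)%N); lra.
have h1 := ler_wpM2r x0 pe2; have h2 := ler_wpM2l (ltW p0) xe.
have r2 : 0 <= p%:R * (r%:R + 2) :> R by rewrite mulr_ge0 //; lra.
have h3 := ler_wpM2r r2 c1.
have p1 : 1 <= p%:R :> R by rewrite ler1n.
have h4 : 1 * (r%:R + 2) <= p%:R * (r%:R + 2) :> R by rewrite ler_wpM2r //; lra.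
by rewrite ler_norml; apply/andP; split; rewrite -(ler_pM2l p0); lra.
Qed.

End Asymptotics.

(** Positions below n suffice for partitions of n; the truncation level n + 1 exceeds the weight n,
    as [boltzmannE] requires. *)
Definition mean_ratio (R : realType) (r m n : nat) : R :=
  (\sum_(d : {ffun 'I_n -> 'I_n.+2} | weight r d == n)
     (mult_ge m d)%:R / (mult_ge 1 d)%:R) /
  #|[pred d : {ffun 'I_n -> 'I_n.+2} | weight r d == n]|%:R.

Lemma ratio_close (R : realType) (x y mx my c eps : R) :
  0 <= c <= 1 -> 0 < eps <= 1 / 4 -> 0 < my -> `|mx - c * my| <= eps * my ->
  `|x - mx| <= eps * mx -> `|y - my| <= eps * my -> `|x / y - c| <= 6 * eps.
Proof.
move=> /andP[c0 c1] /andP[e0 e1] my0; rewrite !ler_norml.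
move=> /andP[l1 u1] /andP[l2 u2] /andP[l3 u3].
have y0 : 0 < y by nra.
have cm : 0 <= c * my by rewrite mulr_ge0 // ltW.
have cm1 : c * my <= my by rewrite ler_piMl // ltW.
have ec : eps * (c * my) <= eps * my by rewrite (ler_wpM2l (ltW e0)).
have ec0 : 0 <= eps * (c * my) by rewrite mulr_ge0 // ltW.
have em : eps * (eps * my) <= 1 / 4 * (eps * my).
  by rewrite ler_wpM2r ?mulr_ge0 ?(ltW e0) ?(ltW my0).
have em0 : 0 <= eps * (eps * my) by rewrite !mulr_ge0 // ltW.
have emx : eps * mx <= eps * (c * my + eps * my) by rewrite (ler_wpM2l (ltW e0)) //; lra.
have emx' : eps * (c * my - eps * my) <= eps * mx by rewrite (ler_wpM2l (ltW e0)) //; lra.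
have cy : c * y <= c * my + eps * (c * my).
  have /(ler_wpM2l c0) : y <= my + eps * my by lra.
  lra.
have cy' : c * my - eps * (c * my) <= c * y.
  have /(ler_wpM2l c0) : my - eps * my <= y by lra.
  lra.
have ey : eps * (my - eps * my) <= eps * y by rewrite (ler_wpM2l (ltW e0)) //; lra.
by apply/andP; split; [rewrite lerBrDr ler_pdivlMr // | rewrite lerBlDr ler_pdivrMr //]; lra.
Qed.

Definition deviant (R : realType) (r n k : nat) (t eps : R) :
    pred {ffun 'I_n -> 'I_n.+2} :=
  fun d => eps * mu r n (k%:R * t) < `|(mult_ge k d)%:R - mu r n (k%:R * t)|.

(** The link between delta and eps makes both Chernoff exponents at least 32 delta v, twice the loss
    16 delta v of [saddle_conditioning] for v = [nu]. *)
Lemma deviant_prob (R : realType) (r n m : nat) (t eps delta v : R) :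
  0 < t -> 0 <= eps <= 1 -> 0 <= delta -> (0 < m <= n)%N ->
  delta * m%:R = (eps / 32) ^+ 2 ->
  v <= 2 * mu r n t -> mu r n t <= 2 * (m%:R * mu r n (m%:R * t)) ->
  \sum_(d : {ffun 'I_n -> 'I_n.+2} | deviant r 1 t eps d || deviant r m t eps d) boltzmann r t d <=
  4 * expR (- (32 * delta * v)).
Proof.
move=> t0 e01 d0 /andP[m0 mn] dm vx xy.
have b1 := mult_ge_concentration r n t0 (ltn0Sn n : (1 <= n.+1)%N) e01.
have bm := mult_ge_concentration r n t0 (leqW mn) e01.
apply: (@le_trans _ _ (\sum_(d : {ffun 'I_n -> 'I_n.+2} | deviant r 1 t eps d) boltzmann r t d +
    \sum_(d : {ffun 'I_n -> 'I_n.+2} | deviant r m t eps d) boltzmann r t d)).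
  rewrite big_mkcond [X in _ <= X + _]big_mkcond [X in _ <= _ + X]big_mkcond -big_split.
  apply: ler_sum => d _; have P0 := boltzmann_ge0 r t0 d.
  by case: deviant; case: deviant; rewrite /= ?addr0 ?add0r ?lerDl.
have e1024 : eps ^+ 2 = 1024 * (delta * m%:R) by rewrite dm; field.
have v1 : expR (- (eps ^+ 2 / 8 * mu r n (1%:R * t))) <= expR (- (32 * delta * v)).
  rewrite ler_expR lerN2 mul1r e1024; move: vx; set x := mu r n t => vx.
  have dv := ler_wpM2l d0 vx.
  have x0 : 0 <= delta * x by rewrite mulr_ge0 // mu_ge0.
  have m1 : 1 <= m%:R :> R by rewrite ler1n.
  have := ler_wpM2r x0 m1; lra.
have vm : expR (- (eps ^+ 2 / 8 * mu r n (m%:R * t))) <= expR (- (32 * delta * v)).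
  rewrite ler_expR lerN2 e1024; have := ler_wpM2l d0 (le_trans vx (ler_wpM2l _ xy)).
  move=> /(_ (ler0n _ _)); lra.
apply: le_trans (lerD b1 bm) _; lra.
Qed.

(** Ratios of non-deviant configurations are within 6 eps of c; the deviant ones form a fraction at
    most eps, and there the ratio and c both lie in [0, 1]. *)
Lemma mean_ratio_close (R : realType) (r m : nat) (c eps : R) :
  (0 < r)%N -> (0 < m)%N -> 0 < c <= 1 -> c ^+ r * m%:R = 1 -> 0 < eps <= 1 / 4 ->
  exists N, forall n, (N <= n)%N -> `|mean_ratio R r m n - c| <= 7 * eps.
Proof.
move=> r0 m0 c01 cm /andP[e0 e4]; have /andP[c0 c1] := c01.
have mR : 1 <= m%:R :> R by rewrite ler1n.
have mR0 : 0 < m%:R :> R by lra.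
have cm1 : 1 <= c * m%:R.
  apply: (@le_trans _ _ (c ^+ r * m%:R)); first by rewrite cm.
  by rewrite ler_wpM2r // -[leRHS]expr1 ler_wiXn2l // ltW.
pose delta : R := (eps / 32) ^+ 2 / m%:R.
have e2 : eps ^+ 2 <= 1 by rewrite expr_le1 ?ltW //; lra.
have e20 : 0 < eps ^+ 2 by rewrite exprn_gt0.
have d0 : 0 < delta by rewrite divr_gt0 // exprn_gt0 // divr_gt0.
have dm : delta * m%:R = (eps / 32) ^+ 2 by rewrite divfK // gt_eqF.
have d1 : delta <= 1 / 2 by rewrite ler_pdivrMr //; lra.
have d01 : 0 <= delta <= 1 / 2 by rewrite ltW.
have d01' : 0 < delta <= 1 / 2 by rewrite d0.
(* Fine enough, as c m >= 1, to give [mu] at m t at least 1 / (2 m) times [mu] at t. *)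
pose eps' : R := eps / (2 * m%:R).
have em' : eps' * (2 * m%:R) = eps by rewrite divfK // gt_eqF // mulr_gt0.
have e'0 : 0 < eps' by rewrite divr_gt0 // mulr_gt0.
have e'e : eps' <= eps / 2.
  by rewrite ler_pdivrMr ?mulr_gt0 // -subr_ge0 (_ : _ - _ = eps * (m%:R - 1));
    [rewrite mulr_ge0 ?subr_ge0 // ltW|field].
have e'01 : 0 < eps' <= 1 by rewrite e'0; lra.
have [V1 hV1] := mu_ratio r0 m0 c01 cm e'01.
have C0 : 0 <= 128 * expR 1 ^+ r :> R by rewrite mulr_ge0 ?ler0n ?exprn_ge0 ?expR_ge0.
have k0 : 0 < 16 * delta by rewrite mulr_gt0.
have [V2 hV2] := expR_beats_pow r.+1 C0 k0 e0.
(* The absolute values make the sum dominate each threshold separately. The square serves the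
   hypothesis of [saddle_window], and 2 (r + 1) gives [nu] <= 2 [mu]. *)
have [N hN] := nu_large r0 (V1 + `|V1| + `|V2| + (64 / delta) ^+ 2 + 2 * (r%:R + 1)) d01.
have [N' hN'] := saddle_exists r0 d01.
exists (maxn N (maxn N' (maxn m 1))) => n; rewrite !geq_max => /and4P[nN nN' nm n0].
have [t sd] := hN' _ nN'; have nuV := hN _ _ nN sd.
pose x := mu r n t; pose y := mu r n (m%:R * t); pose v := nu r n t.
have [t0 _ _] := sd.
have r1 : 1 <= r%:R :> R by rewrite ler1n.
have D0 : 0 <= (64 / delta) ^+ 2 by exact: sqr_ge0.
have nV1 := ler_norm (- V1); rewrite normrN in nV1.
have nV2 := ler_norm V2; have nV20 := normr_ge0 V2; have nV10 := normr_ge0 V1.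
rewrite -/v in nuV.
have v0 : 0 < v by lra.
have xv : v = x + r%:R + 1 by [].
have x2 : v <= 2 * x by lra.
have x0 : 0 < x by lra.
have xy : `|y - c * x| <= eps' * x by apply: (hV1 _ _ _ d01 sd); rewrite -/v; lra.
have xn : 512 * nu r n t <= delta ^+ 2 * mu r n t ^+ 2.
  rewrite -/v -/x; have : 64 ^+ 2 <= delta ^+ 2 * v.
    by rewrite mulrC -ler_pdivrMr ?exprn_gt0 // -expr_div_n; lra.
  have d20 : 0 <= delta ^+ 2 by exact: sqr_ge0.
  move=> /(ler_wpM2r (ltW v0)) h.
  have : v ^+ 2 <= (2 * x) ^+ 2 by rewrite lerXn2r ?nnegrE //; lra.
  move=> /(ler_wpM2l d20) h'; lra.
have ym : x <= 2 * (m%:R * y).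
  have : c * x - eps' * x <= y by move: xy; rewrite ler_norml => /andP[? _]; lra.
  move=> /(ler_wpM2l (ltW mR0)) h.
  have := ler_wpM2r (ltW x0) cm1.
  have : eps' * (2 * m%:R) * x <= 1 / 4 * x by rewrite em' ler_wpM2r // ltW.
  lra.
have y0 : 0 <= y by exact: mu_ge0.
pose B : pred _ := fun d : {ffun 'I_n -> 'I_n.+2} => deviant r 1 t eps d || deviant r m t eps d.
have PB : \sum_(d | B d) boltzmann r t d <= 4 * expR (- (32 * delta * v)).
  apply: deviant_prob => //; first by rewrite ltW //; lra.
    exact: ltW.
  by rewrite m0.
have cond := saddle_conditioning r0 n0 d01' sd xn B.
set q := #|[pred d | _ == _]| in cond; set qB := #|_| in cond.
have q0 : (0 < q)%N.
  have := card_weight_le r n0 (leqnSn n); rewrite -/q.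
  case: (posnP q) => // ->; rewrite muln0 leqn0 => /eqP/card0_eq /(_ [ffun => ord0]).
  by rewrite inE /weight big1 // => i _; rewrite ffunE muln0.
(* The prefactor 2 (n + 1) * 4 is at most 16 n, hence at most 128 e^r v^(r+1), which exp(- 16 delta
   v) beats. *)
have qBq : qB%:R <= eps * q%:R.
  have [_ _ nb] := saddle_bounds r0 d01 sd; rewrite -/v in nb.
  have n2 : n.+1%:R <= 2 * n%:R :> R by rewrite -natrM ler_nat mul2n -addnn -addn1 leq_add2l.
  have hv : 128 * expR 1 ^+ r * v ^+ r.+1 * expR (- (16 * delta * v)) <= eps.
    by apply: hV2; lra.
  apply: (le_trans cond); rewrite -/v.
  apply: le_trans (ler_wpM2l _ PB) _; first by rewrite !mulr_ge0 ?expR_ge0 ?ler0n.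
  have ab : expR (16 * delta * v) * expR (- (32 * delta * v)) = expR (- (16 * delta * v)).
    by rewrite -expRD; congr expR; ring.
  set a := expR (_ * v) in ab *; set b := expR (- (32 * _ * _)) in ab *.
  rewrite (_ : _ * (4 * b) = 8 * n.+1%:R * (a * b) * q%:R); last by ring.
  rewrite ab ler_wpM2r // (le_trans _ hv) // ler_wpM2r ?expR_ge0 //.
  clear - nb n2; lra.
rewrite /mean_ratio -/q.
have qR : 0 < q%:R :> R by rewrite ltr0n.
have xy' : `|y - c * x| <= eps * x.
  by apply: (le_trans xy); rewrite ler_wpM2r ?(ltW x0) //; lra.
clear - c0 c1 e0 e4 m0 x0 y0 xy' qR qBq.
set S := \sum_(d | _) _; have -> : S / q%:R - c = (S - c * q%:R) / q%:R.
  by field; rewrite gt_eqF.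
rewrite normrM normfV (gtr0_norm qR) ler_pdivrMr // /S.
have -> : c * q%:R = \sum_(d : {ffun 'I_n -> 'I_n.+2} | weight r d == n) c.
  by rewrite sumr_const mulr_natr.
rewrite -sumrB; apply: (le_trans (ler_norm_sum _ _ _)).
apply: (@le_trans _ _ (\sum_(d : {ffun 'I_n -> 'I_n.+2} | weight r d == n) (6 * eps + (B d)%:R))).
  apply: ler_sum => d wd; case: (boolP (B d)) => [_|].
    have X1 : (mult_ge m d)%:R <= (mult_ge 1 d)%:R :> R.
      rewrite ler_nat; apply: leq_sum => i _.
      by case: (leqP m (d i)) => // mi; rewrite (leq_trans m0 mi).
    set rho : R := _ / _.
    have rho0 : 0 <= rho by rewrite divr_ge0.
    have rho1 : rho <= 1.
      rewrite /rho; have [->|k0] := eqVneq (mult_ge 1 d) 0%N.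
        by rewrite invr0 mulr0.
      by rewrite ler_pdivrMr ?ltr0n ?lt0n // mul1r.
    by rewrite mulr1n ler_norml; apply/andP; split; lra.
  rewrite negb_or /deviant -!leNgt mul1r => /andP[h1 hm].
  rewrite mulr0n addr0; apply: (@ratio_close _ _ _ y x) => //; last by rewrite e0.
  by rewrite ltW.
rewrite big_split /= sumr_const -[_ *+ _]mulr_natr -/q.
have -> : \sum_(d : {ffun 'I_n -> 'I_n.+2} | weight r d == n) (B d)%:R = qB%:R :> R.
  rewrite /qB -sum1_card natr_sum [RHS]big_mkcondr /=.
  by apply: eq_bigr => d _; case: (B d).
lra.
Qed.

(** * Return to partitions and the limit *)

Lemma diff_partitions_mean (R : realType) (r m n : nat) : (0 < r)%N -> (0 < m)%N ->
  (\sum_(l <- diff_partitions r n) (num_ge r m l)%:R / (num_ge r 1 l)%:R) /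
    #|` diff_partitions r n|%:R = mean_ratio R r m n.
Proof.
move=> r0 m0; rewrite card_fset_sum1 natr_sum.
rewrite !(sum_diff_partitions r0 _ (leqnn n) (leqnSn n)) /mean_ratio.
congr (_ / _); last by rewrite -natr_sum -sum1_card.
by apply: eq_bigr => d _; rewrite !(num_ge_partition_of r0 d).
Qed.

Lemma prob_d_geE (R : realType) (r m n : nat) : (0 < m)%N ->
  prob_d_ge R r n m =
  (\sum_(l <- diff_partitions r n) (num_ge r m l)%:R / (num_ge r 1 l)%:R) /
    #|` diff_partitions r n|%:R.
Proof.
move=> m0; congr (_ / _); apply: eq_bigr => l _.
rewrite /unif_prob /num_ge; congr (_%:R / _%:R).
  congr #|` _|; apply/fsetP => i; rewrite !inE -andbA; congr (_ && _).
  rewrite andb_idl // => mi; apply: lt_le_trans mi; by rewrite ltz_nat.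
Qed.

(** The estimates see m^(-1/r) only through 0 < c <= 1 and c^r m = 1. *)
Lemma mean_ratio_cvg (R : realType) (r m : nat) : (0 < r)%N -> (0 < m)%N ->
  (mean_ratio R r m : nat -> R) @ \oo --> (m%:R `^ (- (r%:R)^-1) : R).
Proof.
move=> r0 m0; set c : R := _ `^ _.
have m1 : 1 <= m%:R :> R by rewrite ler1n.
have c0 : 0 < c by rewrite powR_gt0 // ltr0n.
have c1 : c <= 1 by rewrite -(powRr0 m%:R) ler_powR // oppr_le0 invr_ge0.
have cm : c ^+ r * m%:R = 1.
  rewrite -powR_mulrn ?powR_ge0 // -powRrM mulNr mulVf ?pnatr_eq0 -?lt0n //.
  by rewrite powR_inv1 // mulVf // pnatr_eq0 -lt0n.
apply/cvgrPdist_le => e e0.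
pose eps := Num.min (e / 7) (1 / 4).
have eps0 : 0 < eps <= 1 / 4 by rewrite /eps lt_min ge_min lexx orbT andbT; apply/andP; split; lra.
have epse : 7 * eps <= e.
  have : eps <= e / 7 by rewrite ge_min lexx.
  lra.
have [|N hN] := mean_ratio_close r0 m0 _ cm eps0; first by rewrite c0.
near=> n; rewrite distrC (le_trans _ epse) // hN //.
by near: n; exists N.
Unshelve. all: by end_near.
Qed.

Theorem theorem3 (R : realType) (r m : nat) (hr : (1 <= r)%N) (hm : (1 <= m)%N) :
  (fun n : nat => prob_d_ge R r n m) @ \oo --> (m%:R `^ (- (r%:R)^-1) : R)
  /\
  (fun n : nat =>
     #|` diff_partitions r n|%:R^-1 *
     \sum_(l <- diff_partitions r n) (num_ge r m l)%:R / (num_ge r 1 l)%:R) @ \oo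
    --> (m%:R `^ (- (r%:R)^-1) : R).
Proof.
have cvg := @mean_ratio_cvg R r m hr hm.
split; apply: cvg_trans cvg; apply: near_eq_cvg; near=> n.
  by rewrite prob_d_geE // diff_partitions_mean.
by rewrite mulrC diff_partitions_mean.
Unshelve. all: by end_near.
Qed.
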